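(* Let $\alpha\in(\frac12,1)$, $\lambda\geq0$, $y_0\in\mathbb{R}$, and let $f:(0,b]\times\mathbb{R}\to\mathbb{R}$ be a function such that $f(\cdot,y(\cdot))\in C_{1-\alpha;\Psi}([0,b],\mathbb{R})$ for every $y\in C_{1-\alpha;\Psi}([0,b],\mathbb{R})$. Suppose that $f$ satisfies, for some fixed $L>0$, the Lipschitz condition $$|f(t,u)-f(t,v)|\leq L|u-v|,\qquad u,v\in\mathbb{R},\ t\in(0,b].$$ Then the initial value problem $${}^{TR}\mathcal{D}^{\alpha,\lambda}_{\Psi}\,y(t)=f(t,y(t)),\quad t\in(0,b],\qquad \left[{}^{T}\mathcal{I}^{1-\alpha,\lambda}_{\Psi}\left(e^{\lambda\Psi(t)}y(t)\right)\right]_{t=0}=y_0,$$ has a unique solution $y\in C_{1-\alpha;\Psi}([0,b],\mathbb{R})$, provided that the constant $L$ is less than $$\frac{\Gamma(2\alpha)}{\Gamma(\alpha)}\left(\Psi(b)-\Psi(0)\right)^{-\alpha}e^{-\lambda\Psi(b)}.$$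
   Context: Throughout, $b>0$ is fixed and $\Psi$ is a smooth monotonic real function on $[0,b]$ with $\Psi'>0$ almost everywhere. For $\alpha>0$, $\lambda\in\mathbb{R}$, the $\Psi$-tempered fractional integral is $${}^{T}\mathcal{I}^{\alpha,\lambda}_{\Psi}y(t)=\frac{1}{\Gamma(\alpha)}\int_0^t\Psi'(s)(\Psi(t)-\Psi(s))^{\alpha-1}e^{-\lambda(\Psi(t)-\Psi(s))}y(s)\,\mathrm{d}s.$$ For $\alpha\in(0,1)$, the $\Psi$-tempered fractional derivative of Riemann--Liouville type is ${}^{TR}\mathcal{D}^{\alpha,\lambda}_{\Psi}y(t)=\left(\frac{1}{\Psi'(t)}\frac{\mathrm{d}}{\mathrm{d}t}+\lambda\right){}^{T}\mathcal{I}^{1-\alpha,\lambda}_{\Psi}y(t)$. $[\,\cdot\,]_{t=0}$ denotes the value at $t=0$ (limit as $t\to0^+$). For $\gamma\in(0,1)$, $C_{\gamma;\Psi}([0,b],\mathbb{R})$ is the space of functions $h:(0,b]\to\mathbb{R}$ such that $(\Psi(\cdot)-\Psi(0))^{\gamma}h(\cdot)\in C[0,b]$. *)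

(* Defs.v *)
From HB Require Import structures.
From mathcomp Require Import all_boot all_order all_algebra.
From mathcomp Require Import all_classical all_reals all_analysis.
Set Implicit Arguments.
Unset Strict Implicit.
Unset Printing Implicit Defensive.
Import Order.TTheory GRing.Theory Num.Theory.
Import numFieldNormedType.Exports.

Local Open Scope classical_set_scope.
Local Open Scope ring_scope.

Section Calculus.
Context {R : realType}.

(* Derivatives are taken relatively to the set A, so that they are one-sided
   at the end points when A = [0, b]; the values of g outside A are
   irrelevant at the points of A. *)
Definition diff_quot_in (A : set R) (g : R -> R) (t : R) : set_system R :=
  (fun s : R => (g s - g t) / (s - t)) @ within A t^'.

Definition derivable_in (A : set R) (g : R -> R) (t : R) : Prop :=
  cvg (diff_quot_in A g t).

Definition derive_in (A : set R) (g : R -> R) (t : R) : R :=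
  lim (diff_quot_in A g t).

Definition smooth_in (A : set R) (g : R -> R) : Prop :=
  forall (n : nat) (t : R), A t -> derivable_in A (iter n (derive_in A) g) t.

Definition Gamma (a : R) : R :=
  \int[lebesgue_measure]_(x in `]0, +oo[) (x `^ (a - 1) * expR (- x)).

End Calculus.

Section TemperedCalculus.
Context {R : realType}.
Variables (b : R) (Psi : R -> R).

(* A function (0, b] -> R is encoded as a function R -> R of which only the
   values on (0, b] matter. *)

Definition dPsi : R -> R := derive_in `[0, b] Psi.

Definition tempered_int (alpha lambda : R) (y : R -> R) (t : R) : R :=
  (Gamma alpha)^-1 *
  \int[lebesgue_measure]_(s in `[0, t])
    (dPsi s * (Psi t - Psi s) `^ (alpha - 1)
       * expR (- (lambda * (Psi t - Psi s))) * y s).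

(* The operator involves d/dt, and 1 / Psi'(t): its value is meaningful at t
   only if the integral of order 1 - alpha is derivable at t and
   Psi'(t) != 0. *)
Definition tempered_RL_derive (alpha lambda : R) (y : R -> R) (t : R) : R :=
  let g := tempered_int (1 - alpha) lambda y in
  (dPsi t)^-1 * derive_in `[0, b] g t + lambda * g t.

(* The extension h is needed because (Psi t - Psi 0) `^ gamma * y t has the
   value 0 at t = 0, whatever its limit at 0+ is. *)
Definition weighted_C (gamma : R) (y : R -> R) : Prop :=
  exists h : R -> R, {within `[0, b], continuous h} /\
    (forall t : R, 0 < t <= b -> h t = (Psi t - Psi 0) `^ gamma * y t).

(* The integral of order 1 - alpha of a solution is derivable on all of
   (0, b]. As Psi' is positive only almost everywhere, 1 / Psi' may be
   undefined at some points (where, in Rocq, it would be 0): the equation is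
   required at all points of (0, b] where it makes sense. *)
Definition tempered_IVP_solution (alpha lambda y0 : R) (f : R -> R -> R)
    (y : R -> R) : Prop :=
  [/\ weighted_C (1 - alpha) y,
      (forall t : R, 0 < t <= b ->
         derivable_in `[0, b] (tempered_int (1 - alpha) lambda y) t),
      (forall t : R, 0 < t <= b -> dPsi t != 0 ->
         tempered_RL_derive alpha lambda y t = f t (y t)) &
      tempered_int (1 - alpha) lambda
        (fun s => expR (lambda * Psi s) * y s) t @[t --> 0^'+] --> y0].

End TemperedCalculus.

(* Main.v *)
(* Put P t = Psi t - Psi 0 and y t = exp(-lambda Psi t) P(t)^(alpha-1) h(P t).
   The substitution x = P t turns the problem into one for a continuous
   function h, and the fractional integrals into averages
   x |-> \int_0^1 (1-v)^p v^q h(xv) dv against a beta density.  By Tonelli, the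
   Riesz kernels of orders alpha and 1 - alpha compose to a constant multiple of
   the integration operator, so that the problem is equivalent to the Volterra
   equation
     h x = c0 + k0 x^alpha \int_0^1 ((1-v) v)^(alpha-1) (N h)(xv) dv,
   where N is the superposition operator of f.  This is a contraction for the
   norm weighted by exp(K x) when K is large, because exp(-w) <= w^(-alpha/2)
   makes the weighted beta integral at most of order K^(-alpha/2).

   Since Psi' may vanish on a null set, where the equation gives no information,
   going from the problem to the Volterra equation needs the theorem of
   Goldowsky and Tonelli: a function that is differentiable everywhere, with
   zero derivative almost everywhere, is constant. *)
Require Import Defs.
From HB Require Import structures.
From mathcomp Require Import all_boot all_order all_algebra.
From mathcomp Require Import all_classical all_reals all_analysis.
From mathcomp Require Import measurable_realfun.
From mathcomp Require Import ring lra.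
Import Order.TTheory GRing.Theory Num.Theory.
Import numFieldNormedType.Exports.
Local Open Scope classical_set_scope.
Local Open Scope ring_scope.

(** * Substitution with singular end points *)

(** The tempering drops out of the change of unknown because exp(-lambda (Psi t - Psi s))
    exp(-lambda Psi s) does not depend on s. Functions of x are taken bounded and continuous on the
    whole line, those given on [0, P b] being extended by constants: dominating functions are then
    immediate, and the primitives have two-sided derivatives even at P b.

    Kernels of orders alpha and 1 - alpha have exponents with sum -1; this homogeneity is what makes
    the inner integral in Tonelli's theorem the constant B = [beta (- alpha) (alpha - 1)].
    Classically B = Gamma(alpha) Gamma(1 - alpha), whence k0 = 1 / Gamma(alpha); the proof keeps B
    itself and only uses that it is positive.

    For a solution, the equation yields a zero derivative only off the zeros of Psi'. An argument by
    null sets alone would fail on functions of Cantor type; differentiability at every point is what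
    excludes them. The resulting identity concerns the average of h of order 1 - alpha, so that one
    still has to invert Abel's equation: the complementary kernel turns the average into a
    primitive, which is then differentiated. *)

Section substitution.
Context {R : realType}.
Notation mu := (@lebesgue_measure R).

(** Dividing by [n.+3] removes at most a third of the length at either end, so that no segment is
    degenerate. *)
Let shrinkl (a b : R) (n : nat) := a + (b - a) / n.+3%:R.
Let shrinkr (a b : R) (n : nat) := b - (b - a) / n.+3%:R.

Let shrink_lt (a b : R) n : a < b ->
  [/\ a < shrinkl a b n, shrinkl a b n < shrinkr a b n & shrinkr a b n < b].
Proof.
move=> ab; rewrite /shrinkl /shrinkr.
have ba : 0 < b - a by rewrite subr_gt0.
have h0 : 0 < (b - a) / n.+3%:R by rewrite divr_gt0.
have : (b - a) / n.+3%:R * 3 <= b - a.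
  by rewrite mulrAC ler_pdivrMr// ler_pM2l// ler_nat.
by move: (_ / _) h0 => d d0 d3; split; lra.
Qed.

Let shrink_nd (a b : R) : a < b ->
  nondecreasing_seq (fun n => `[shrinkl a b n, shrinkr a b n]%classic).
Proof.
move=> ab m n mn; rewrite subsetEset; apply: subset_itvScc; rewrite bnd_simp.
  by rewrite lerD2l ler_pM2l ?subr_gt0// lef_pV2 ?posrE// ler_nat.
by rewrite lerD2l lerN2 ler_pM2l ?subr_gt0// lef_pV2 ?posrE// ler_nat.
Qed.

Let shrink_ex (a b x : R) : a < x < b ->
  exists n, `[shrinkl a b n, shrinkr a b n]%classic x.
Proof.
move=> /andP[ax xb].
have ba : 0 < b - a by lra.
pose d := Num.min (x - a) (b - x).
have d0 : 0 < d by rewrite lt_min !subr_gt0 ax xb.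
have [N bN] : exists N, (b - a) / d < N%:R.
  exists (Num.trunc ((b - a) / d)).+1.
  by rewrite truncnS_gt// divr_ge0// ltW.
exists N; rewrite /= in_itv/= /shrinkl /shrinkr.
have : (b - a) / N.+3%:R <= d.
  rewrite ler_pdivrMr// mulrC -ler_pdivrMr// (le_trans (ltW bN))// ler_nat.
  by rewrite -addn3 leq_addr.
rewrite /d le_min; move: (_ / _) => e /andP[h1 h2].
by apply/andP; split; lra.
Qed.

(* G and f may be singular at the end points: exhaust ]a, b[ by segments. *)
Lemma ge0_integration_by_substitution_oo (F f G : R -> R) (a b : R) : a < b ->
  {in `[a, b] &, {homo F : x y / x < y}} ->
  {within `[a, b], continuous F} ->
  (forall x, a < x < b -> is_derive x 1 F (f x)) ->
  {in `]a, b[, continuous f} ->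
  (forall y, F a < y < F b -> {for y, continuous G}) ->
  (forall y, 0 <= G y) ->
  (\int[mu]_(x in `]a, b[) (G (F x) * f x)%:E =
   \int[mu]_(y in `]F a, F b[) (G y)%:E)%E.
Proof.
move=> ab Fi Fc Fd fc Gc G0.
set l := shrinkl a b; set r := shrinkr a b.
have lr n : [/\ a < l n, l n < r n & r n < b] by exact: shrink_lt.
have inab x : a < x < b -> x \in `[a, b].
  by rewrite in_itv/= => /andP[/ltW-> /ltW->].
have Fab x : a < x < b -> F a < F x < F b.
  move=> xab; have := inab _ xab; move: xab => /andP[ax xb] xab.
  by rewrite !Fi// in_itv/= lexx ltW// (lt_trans ax).
have linab n : a < l n < b.
  by have [h1 h2 h3] := lr n; rewrite h1/= (lt_trans h2).
have rinab n : a < r n < b.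
  by have [h1 h2 h3] := lr n; rewrite h3/= (lt_trans h1).
have -> : `]a, b[%classic = \bigcup_n `[l n, r n]%classic.
  apply/seteqP; split => x /=.
    by rewrite in_itv/= => /shrink_ex[n xn]; exists n.
  move=> [n _] /=; rewrite !in_itv/= => /andP[lx xr].
  have [h1 h2 h3] := lr n.
  by rewrite (lt_le_trans h1 lx) (le_lt_trans xr h3).
have Fle x y : x \in `[a, b] -> y \in `[a, b] -> x <= y -> F x <= F y.
  by move=> xi yi; rewrite le_eqVlt => /predU1P[->//|xy]; rewrite ltW// Fi.
have -> : `]F a, F b[%classic = \bigcup_n `[F (l n), F (r n)]%classic.
  apply/seteqP; split => y /=.
    rewrite in_itv/= => /andP[ay yb].
    have FaFb : F a <= F b by rewrite (le_trans (ltW ay) (ltW yb)).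
    have := @segment_continuous_le_surjective R a b F (ltW ab) FaFb Fc.
    move=> /(_ y); rewrite /= in_itv/= (ltW ay) (ltW yb) => /(_ isT)[x].
    rewrite /= in_itv/= => /andP[ax xb] Fxy.
    have [n xn] : exists n, `[shrinkl a b n, shrinkr a b n]%classic x.
      apply: shrink_ex; rewrite !lt_neqAle ax xb !andbT; apply/andP; split.
        by apply/eqP => xa; move: ay; rewrite -Fxy xa ltxx.
      by apply/eqP => xa; move: yb; rewrite -Fxy xa ltxx.
    exists n => //=; move: xn; rewrite /= !in_itv/= -Fxy => /andP[h1 h2].
    have xi : x \in `[a, b] by rewrite in_itv/= ax.
    by rewrite (Fle _ _ (inab _ (linab n)) xi h1) (Fle _ _ xi (inab _ (rinab n)) h2).
  move=> [n _] /=; rewrite !in_itv/= => /andP[h1 h2].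
  have /andP[h3 _] := Fab _ (linab n); have /andP[_ h4] := Fab _ (rinab n).
  by rewrite (lt_le_trans h3 h1) (le_lt_trans h2 h4).
(* The monotonicity of F forces the sign of f, and monotone convergence along the segments requires
   nonnegative integrands on both sides. *)
have f0 x : a < x < b -> 0 <= f x.
  move=> xab; have Fdx := Fd _ xab.
  rewrite -(@derive_val _ _ _ _ _ _ _ Fdx) -derive1E.
  have xab' : x \in `]a, b[ by rewrite in_itv.
  apply: (@incr_derive1_ge0_itv _ F true false a b) => // z.
  by rewrite inE/= in_itv/= => zab; have [] := Fd _ zab.
have cF x : a < x < b -> {for x, continuous F}.
  move=> /Fd[Fx _]; apply: differentiable_continuous.
  exact/derivable1_diffP.
have subl n : `[l n, r n]%classic `<=` `]a, b[%classic.
  move=> x /=; rewrite !in_itv/= => /andP[h3 h4]; have [aln lnrn rnb] := lr n.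
  by rewrite (lt_le_trans aln h3) (le_lt_trans h4 rnb).
have subF n : `[F (l n), F (r n)]%classic `<=` `]F a, F b[%classic.
  move=> y /=; rewrite !in_itv/= => /andP[h1 h2].
  have /andP[h3 _] := Fab _ (linab n); have /andP[_ h4] := Fab _ (rinab n).
  by rewrite (lt_le_trans h3 h1) (le_lt_trans h2 h4).
(* The substitution rule on a segment is stated with [derive1 F], which inherits its continuity from
   f because the two agree near x. *)
have cF' x : a < x < b -> {for x, continuous (derive1 F)}.
  move=> xab; suff : (derive1 F) z @[z --> x] --> (derive1 F) x by [].
  rewrite [X in _ --> X]derive1E.
  have Fdx := Fd _ xab; rewrite derive_val.
  have : f z @[z --> x] --> f x by apply: fc; rewrite in_itv.
  apply: cvg_trans; apply: near_eq_cvg.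
  near=> z; have zab : a < z < b.
    have : z \in `]a, b[ by near: z; apply: near_in_itvoo; rewrite in_itv.
    by rewrite in_itv.
  by have Fdz := Fd _ zab; rewrite derive1E derive_val.
have mf n : measurable_fun `[l n, r n] (fun x => G (F x) * f x).
  apply: (measurable_funS (measurable_itv _) (subl n)).
  apply: open_continuous_measurable_fun => // x.
  rewrite inE/= in_itv/= => xab.
  apply: cvgM; last by apply: fc; rewrite in_itv.
  by apply: continuous_comp; [exact: cF|apply: Gc; exact: Fab].
have mG n : measurable_fun `[F (l n), F (r n)] G.
  apply: (measurable_funS (measurable_itv _) (subF n)).
  apply: open_continuous_measurable_fun => // x.
  by rewrite inE/= in_itv/= => /Gc.
have h1 : (\int[mu]_(x in `[l i, r i]) (G (F x) * f x)%:E @[i --> \oo] -->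
  \int[mu]_(x in \bigcup_i `[l i, r i]%classic) (G (F x) * f x)%:E)%E.
  apply: ge0_nondecreasing_set_cvg_integral => //; first exact: shrink_nd.
    by move=> n; apply/measurable_EFinP; exact: mf.
  move=> n x /=; rewrite in_itv/= => /andP[lx xr].
  rewrite lee_fin mulr_ge0// f0//.
  have [h3 _ h4] := lr n.
  by rewrite (lt_le_trans h3 lx) (le_lt_trans xr h4).
have h2 : (\int[mu]_(x in `[F (l i), F (r i)]) (G x)%:E @[i --> \oo] -->
  \int[mu]_(x in \bigcup_i `[F (l i), F (r i)]%classic) (G x)%:E)%E.
  apply: ge0_nondecreasing_set_cvg_integral => //; last 2 first.
  - by move=> n; apply/measurable_EFinP; exact: mG.
  - by move=> n x _; rewrite lee_fin.
  - move=> m n mn; rewrite subsetEset; apply: subset_itvScc; rewrite bnd_simp.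
      apply: Fle; rewrite ?inab//.
      by have := shrink_nd _ _ ab _ _ mn; rewrite subsetEset => /(_ (l m)) /=;
        rewrite !in_itv/= lexx/=; have [_ /ltW -> _] := lr m => /(_ isT)/andP[].
    apply: Fle; rewrite ?inab//.
    by have := shrink_nd _ _ ab _ _ mn; rewrite subsetEset => /(_ (r m)) /=;
      rewrite !in_itv/= lexx andbT; have [_ /ltW -> _] := lr m => /(_ isT)/andP[].
suff e : (fun i => \int[mu]_(x in `[l i, r i]) (G (F x) * f x)%:E)%E =
    (fun i => \int[mu]_(x in `[F (l i), F (r i)]) (G x)%:E)%E.
  by rewrite e in h1; apply: (cvg_unique _ h1 h2); exact: ereal_hausdorff.
apply/funext => n.
have [aln lnrn rnb] := lr n.
have sub x : l n <= x <= r n -> a < x < b.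
  by move=> /andP[h3 h4]; rewrite (lt_le_trans aln h3) (le_lt_trans h4 rnb).
rewrite (@integration_by_substitution_increasing _ F G _ _ (ltW lnrn)).
- apply: eq_integral => x; rewrite inE/= in_itv/= => /sub xab.
  by have Fdx := Fd _ xab; rewrite !fctE derive1E derive_val.
- move=> x y; rewrite !in_itv/= => /sub xab /sub yab; apply: Fi; exact: inab.
- by move=> x; rewrite in_itv/= => /andP[/ltW h3 /ltW h4]; apply: cF'; rewrite sub// h3.
- apply/cvg_ex; exists ((derive1 F) (l n)); apply: cvg_at_right_filter.
  exact/cF'/linab.
- apply/cvg_ex; exists ((derive1 F) (r n)); apply: cvg_at_left_filter.
  exact/cF'/rinab.
- split.
  + move=> x; rewrite in_itv/= => /andP[/ltW h3 /ltW h4].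
    by have [] := Fd x (sub _ _); rewrite ?h3.
  + by apply: cvg_at_right_filter; exact/cF/linab.
  + by apply: cvg_at_left_filter; exact/cF/rinab.
- apply: continuous_in_subspaceT => x /set_mem /subF/=.
  by rewrite in_itv/= => /Gc.
Unshelve. all: by end_near. Qed.

(** Positive and negative parts are compared separately in the extended reals, so that the equality
    also covers non-integrable G. The end points, where G and f may be singular, are first discarded
    as a null set. *)
Lemma integration_by_substitution_cc (F f G : R -> R) (a b : R) : a < b ->
  {in `[a, b] &, {homo F : x y / x < y}} ->
  {within `[a, b], continuous F} ->
  (forall x, a < x < b -> is_derive x 1 F (f x)) ->
  {in `]a, b[, continuous f} ->
  (forall y, F a < y < F b -> {for y, continuous G}) ->
  (\int[mu]_(x in `[a, b]) (G (F x) * f x) =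
   \int[mu]_(y in `[F a, F b]) G y).
Proof.
move=> ab Fi Fc Fd fc Gc; rewrite /Rintegral; congr fine.
have f0 x : a < x < b -> 0 <= f x.
  move=> xab; have Fdx := Fd _ xab.
  rewrite -(@derive_val _ _ _ _ _ _ _ Fdx) -derive1E.
  have xab' : x \in `]a, b[ by rewrite in_itv.
  apply: (@incr_derive1_ge0_itv _ F true false a b) => // z.
  by rewrite inE/= in_itv/= => zab; have [] := Fd _ zab.
have cF x : a < x < b -> {for x, continuous F}.
  move=> /Fd[Fx _]; apply: differentiable_continuous.
  exact/derivable1_diffP.
have Fab x : a < x < b -> F a < F x < F b.
  by move=> /andP[ax xb]; rewrite !Fi// in_itv/= ?lexx ?(ltW ab) ?(ltW ax) ?(ltW xb).
have mGF : measurable_fun `]a, b[ (fun x => G (F x) * f x).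
  apply: open_continuous_measurable_fun => // x.
  rewrite inE/= in_itv/= => xab.
  apply: cvgM; last by apply: fc; rewrite in_itv.
  by apply: continuous_comp; [exact: cF|apply: Gc; exact: Fab].
have mG : measurable_fun `]F a, F b[ G.
  apply: open_continuous_measurable_fun => // x.
  by rewrite inE/= in_itv/= => /Gc.
rewrite integral_itv_bndoo; last by apply/measurable_EFinP; exact: mGF.
rewrite [RHS]integral_itv_bndoo; last by apply/measurable_EFinP; exact: mG.
have pos (H : R -> R) : (forall y, F a < y < F b -> {for y, continuous H}) ->
    (forall y, 0 <= H y) ->
  (\int[mu]_(x in `]a, b[) (H (F x) * f x)%:E =
   \int[mu]_(y in `]F a, F b[) (H y)%:E)%E.
  by move=> Hc H0; exact: ge0_integration_by_substitution_oo.
rewrite integralE [RHS]integralE; congr (_ - _)%E.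
- transitivity (\int[mu]_(y in `]F a, F b[) (Num.max (G y) 0)%:E)%E; last first.
    by apply: eq_integral => y _; rewrite funeposE EFin_max.
  rewrite -(pos (fun y => Num.max (G y) 0)) => [|y /Gc Gy|y].
  + apply: eq_integral => x; rewrite inE/= in_itv/= => /f0 fx0.
    by rewrite funeposE -EFin_max maxr_pMl// mul0r.
  + by apply: continuous_max => //; exact: cvg_cst.
  + by rewrite le_max lexx orbT.
- transitivity (\int[mu]_(y in `]F a, F b[) (Num.max (- G y) 0)%:E)%E; last first.
    by apply: eq_integral => y _; rewrite funenegE EFin_max.
  rewrite -(pos (fun y => Num.max (- G y) 0)) => [|y /Gc Gy|y].
  + apply: eq_integral => x; rewrite inE/= in_itv/= => /f0 fx0.
    by rewrite funenegE -EFinN -EFin_max maxr_pMl// mul0r mulNr.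
  + by apply: continuous_max; [exact: cvgN|exact: cvg_cst].
  + by rewrite le_max lexx orbT.
Qed.

End substitution.

(** * Beta averages and Riesz kernels *)

Section beta_kernel.
Context {R : realType}.
Notation mu := (@lebesgue_measure R).

Lemma continuous_powR (a x : R) : 0 < x -> {for x, continuous (@powR R ^~ a)}.
Proof.
move=> x0; apply: differentiable_continuous; apply/derivable1_diffP.
by apply: derivable_powR; rewrite in_itv/= x0.
Qed.

Lemma within_continuous_powR (a X : R) : 0 < a -> 0 < X ->
  {within `[0, X], continuous (@powR R ^~ a)}.
Proof.
move=> a0 X0; apply/continuous_within_itvP => //; split.
- by move=> x; rewrite in_itv/= => /andP[x0 _]; exact: continuous_powR.
- by rewrite powR0 ?gt_eqF//; exact: powR_cvg0.
- by apply: cvg_at_left_filter; exact: continuous_powR.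
Qed.

Lemma measurable_powR_onem (p : R) (D : set R) :
  measurable_fun D (fun v : R => (1 - v) `^ p).
Proof.
apply: (@measurable_funTS _ _ _ _ D).
apply: (measurableT_comp (measurable_powR p)).
exact: measurable_funB.
Qed.

Lemma integrable_itv_bndoo (f : R -> R) (a b : R) :
  measurable_fun setT f ->
  mu.-integrable `]a, b[ (EFin \o f) -> mu.-integrable `[a, b] (EFin \o f).
Proof.
move=> mf /integrableP[_ h]; apply/integrableP; split.
  by apply/measurable_EFinP; exact: measurable_funTS.
rewrite integral_itv_bndoo//; apply: measurableT_comp => //.
by apply/measurable_EFinP; exact: measurable_funTS.
Qed.

(** The substitution y = x^(q + 1) turns the integral into the length of an interval, up to the
    factor q + 1. Its derivative may blow up at 0, whence the need for a substitution rule with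
    singular end points. *)
Lemma integrable_powR (q X : R) : -1 < q -> 0 < X ->
  mu.-integrable `[0, X] (EFin \o (@powR R ^~ q)).
Proof.
move=> q1 X0; pose a := q + 1.
have a0 : 0 < a by rewrite /a; lra.
apply: integrable_itv_bndoo; first exact: measurable_powR.
have aE : a - 1 = q by rewrite /a; lra.
(* The factor 1 is the constant G of the substitution rule, and a x^(a - 1) is the derivative of
   x^a. *)
suff : mu.-integrable `]0, X[ (EFin \o (fun x => 1 * (a * x `^ (a - 1)))).
  move=> /(@integrableZl _ _ _ mu _ (measurable_itv _) a^-1).
  apply: eq_integrable => // x _.
  by rewrite /= -EFinM aE mul1r mulrA mulVf ?gt_eqF// mul1r.
apply/integrableP; split.
  apply/measurable_EFinP; apply: measurable_funM => //.
  by apply: measurable_funM => //; apply: measurable_funTS; exact: measurable_powR.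
rewrite [ltLHS](_ : _ =
    (\int[mu]_(x in `]0%R, X[) (1 * (a * x `^ (a - 1)))%:E)%E); last first.
  apply: eq_integral => x _; rewrite /= ger0_norm// mul1r mulr_ge0 ?powR_ge0//; exact: ltW.
rewrite [ltLHS](_ : _ =
    (\int[mu]_(y in `](0 `^ a)%R, (X `^ a)%R[) (cst 1 : R -> \bar R) y)%E); last first.
  apply: (@ge0_integration_by_substitution_oo R (@powR R ^~ a)
    (fun x => a * x `^ (a - 1)) (cst 1)) => //.
  - move=> x y; rewrite !in_itv/= => /andP[x0 _] /andP[y0 _].
    by apply: gt0_ltr_powR; rewrite ?nnegrE.
  - exact: within_continuous_powR.
  - by move=> x /andP[x0 _]; exact: is_derive1_powR.
  - move=> x; rewrite in_itv/= => /andP[x0 _].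
    by apply: cvgM; [exact: cvg_cst|exact: continuous_powR].
  - by move=> y _; exact: cvg_cst.
rewrite integral_cst//= mul1e lebesgue_measure_itv/=.
by case: ifPn => _; rewrite ?ltry// -EFinD ltry.
Qed.

(** The singularity is now at 1. As the substitution rule asks for an increasing map, the reflection
    v -> 1 - v is replaced by the primitive 1 - (1 - x)^(q + 1). *)
Lemma integrable_powR_onem (q : R) : -1 < q ->
  mu.-integrable `[0, 1] (EFin \o (fun v => (1 - v) `^ q)).
Proof.
move=> q1; pose a := q + 1.
have a0 : 0 < a by rewrite /a; lra.
apply: integrable_itv_bndoo; first exact: measurable_powR_onem.
have aE : a - 1 = q by rewrite /a; lra.
suff : mu.-integrable `]0, 1[ (EFin \o (fun x => 1 * (a * (1 - x) `^ (a - 1)))).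
  move=> /(@integrableZl _ _ _ mu _ (measurable_itv _) a^-1).
  apply: eq_integrable => // x _.
  by rewrite /= -EFinM aE mul1r mulrA mulVf ?gt_eqF// mul1r.
apply/integrableP; split.
  apply/measurable_EFinP; apply: measurable_funM => //.
  by apply: measurable_funM => //; exact: measurable_powR_onem.
rewrite [ltLHS](_ : _ =
    (\int[mu]_(x in `]0%R, 1%R[) (1 * (a * (1 - x) `^ (a - 1)))%:E)%E); last first.
  apply: eq_integral => x _; rewrite /= ger0_norm// mul1r mulr_ge0 ?powR_ge0//; exact: ltW.
have dF (x : R) : x < 1 ->
    is_derive x 1 (fun x => 1 - (1 - x) `^ a) (a * (1 - x) `^ (a - 1)).
  move=> x1.
  have h1 : is_derive (1 - x) 1 (@powR R ^~ a) (a * (1 - x) `^ (a - 1)).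
    by apply: is_derive1_powR; rewrite subr_gt0.
  have h2 : is_derive x 1 (fun x : R => 1 - x) (- 1).
    rewrite -[-1]sub0r.
    exact: (is_deriveB (is_derive_cst (1 : R) x (1 : R)) (is_derive_id x (1 : R))).
  have := @is_derive1_comp R (@powR R ^~ a) (fun x : R => 1 - x) x _ _ h1 h2.
  set d := a * _ => h3.
  have -> : d = 0 - (d * -1) by lra.
  exact: (is_deriveB (is_derive_cst (1 : R) x (1 : R)) h3).
pose F (x : R) := 1 - (1 - x) `^ a.
rewrite [ltLHS](_ : _ =
    (\int[mu]_(y in `](F 0%R), (F 1%R)[) (cst 1 : R -> \bar R) y)%E); last first.
  apply: (@ge0_integration_by_substitution_oo R F
    (fun x => a * (1 - x) `^ (a - 1)) (cst 1)) => //.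
  - move=> x y; rewrite !in_itv/= => /andP[x0 x1] /andP[y0 y1] xy.
    by rewrite ltrD2l ltrN2 gt0_ltr_powR ?nnegrE// ?subr_ge0// ltrD2l ltrN2.
  - apply/continuous_within_itvP => //; split.
    + move=> x; rewrite in_itv/= => /andP[_ x1].
      apply: differentiable_continuous; apply/derivable1_diffP.
      by have [] := dF _ x1.
    + apply: cvg_at_right_filter.
      apply: differentiable_continuous; apply/derivable1_diffP.
      by have [] := dF _ ltr01.
    + rewrite /F subrr powR0 ?gt_eqF//.
      apply: cvgB; first exact: cvg_cst.
      apply/cvgrPdist_lt => e e0.
      have := powR_cvg0 a0 => /cvgrPdist_lt/(_ e e0)[d /= d0 hd].
      near=> x; apply: (hd (1 - x)); last by rewrite subr_gt0.
      rewrite /ball/= sub0r normrN gtr0_norm ?subr_gt0// ltrBlDr -ltrBlDl.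
      by near: x; apply: nbhs_left_gt; rewrite ltrBlDr ltrDl.
  - by move=> x /andP[_ x1]; exact: dF.
  - move=> x; rewrite in_itv/= => /andP[_ x1].
    apply: cvgM; first exact: cvg_cst.
    apply: (@continuous_comp _ _ _ (fun x : R => 1 - x) (@powR R ^~ (a - 1))).
      by apply: cvgB; [exact: cvg_cst|exact: cvg_id].
    by apply: continuous_powR; rewrite subr_gt0.
  - by move=> y _; exact: cvg_cst.
rewrite integral_cst//= mul1e lebesgue_measure_itv/=.
by case: ifPn => _; rewrite ?ltry// -EFinD ltry.
Unshelve. all: by end_near. Qed.

(** Since a power of 0 with nonzero exponent is 0, a negative exponent gives the kernel the value 0,
    not an infinite one, at the corresponding end point. *)
Definition beta_kernel (p q v : R) : R := (1 - v) `^ p * v `^ q.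

Lemma beta_kernel_ge0 (p q v : R) : 0 <= beta_kernel p q v.
Proof. by rewrite mulr_ge0 ?powR_ge0. Qed.

Lemma measurable_beta_kernel (p q : R) (D : set R) :
  measurable_fun D (beta_kernel p q).
Proof.
apply: measurable_funM; first exact: measurable_powR_onem.
by apply: measurable_funTS; exact: measurable_powR.
Qed.

Lemma ler_npowR (p x y : R) : p <= 0 -> 0 < x -> x <= y -> y `^ p <= x `^ p.
Proof.
move=> p0 x0 xy; have y0 : 0 < y by exact: lt_le_trans xy.
rewrite -[p]opprK !(powRN _ (- p)) lef_pV2 ?posrE ?powR_gt0//.
by apply: ge0_ler_powR; rewrite ?nnegrE ?oppr_ge0// ltW.
Qed.

Lemma integrable_beta_kernel (p q : R) : -1 < p <= 0 -> -1 < q <= 0 ->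
  mu.-integrable `[0, 1] (EFin \o beta_kernel p q).
Proof.
move=> /andP[p1 p0] /andP[q1 q0].
(* On each half of [0, 1] one factor is not singular and, its exponent being nonpositive, is largest
   at v = 1/2; the other factor is integrable. *)
pose g (v : R) := 2^-1 `^ p * v `^ q + 2^-1 `^ q * (1 - v) `^ p.
have gi : mu.-integrable `[0, 1] (EFin \o g).
  have h1 : mu.-integrable `[0, 1] (fun v => (2^-1 `^ p)%:E * (v `^ q)%:E)%E.
    by apply: integrableZl => //; exact: integrable_powR.
  have h2 : mu.-integrable `[0, 1] (fun v => (2^-1 `^ q)%:E * ((1 - v) `^ p)%:E)%E.
    by apply: integrableZl => //; exact: integrable_powR_onem.
  by apply: eq_integrable (integrableD _ h1 h2).
apply: (@le_integrable _ _ _ mu _ _ _ (EFin \o g)) => //.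
  by apply/measurable_EFinP; exact: measurable_beta_kernel.
move=> v /=; rewrite in_itv/= => /andP[v0 v1].
rewrite lee_fin !ger0_norm ?beta_kernel_ge0//; last first.
  by rewrite addr_ge0// mulr_ge0// powR_ge0.
rewrite /g /beta_kernel; have [v2|v2] := leP v 2^-1.
  rewrite -[leLHS]addr0 lerD ?mulr_ge0 ?powR_ge0//.
  by rewrite ler_wpM2r ?powR_ge0// ler_npowR//; lra.
rewrite -[leLHS]add0r lerD ?mulr_ge0 ?powR_ge0// mulrC.
by rewrite ler_wpM2r ?powR_ge0// ler_npowR//; lra.
Qed.

End beta_kernel.

Section beta_average.
Context {R : realType}.
Notation mu := (@lebesgue_measure R).

(** The bound on the whole line provides a constant multiple of the kernel as dominating function,
    for all values of the parameter x at once. *)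
Definition bounded_continuous (h : R -> R) :=
  continuous h /\ exists M, forall x, `|h x| <= M.

Lemma bounded_continuous_cst (c : R) : bounded_continuous (cst c).
Proof. by split; [move=> x; exact: cvg_cst|exists `|c|]. Qed.

Lemma bounded_continuousM (h k : R -> R) : bounded_continuous h ->
  bounded_continuous k -> bounded_continuous (fun x => h x * k x).
Proof.
move=> [hc [M hM]] [kc [N kN]]; split; first by move=> x; apply: cvgM; [exact: hc|exact: kc].
by exists (M * N) => x; rewrite normrM ler_pM.
Qed.

Lemma bounded_continuousB (h k : R -> R) : bounded_continuous h ->
  bounded_continuous k -> bounded_continuous (fun x => h x - k x).
Proof.
move=> [hc [M hM]] [kc [N kN]]; split; first by move=> x; apply: cvgB; [exact: hc|exact: kc].
by exists (M + N) => x; rewrite (le_trans (ler_normB _ _))// lerD.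
Qed.

Lemma bounded_continuous_max0 (h : R -> R) : bounded_continuous h ->
  bounded_continuous (fun x => Num.max (h x) 0).
Proof.
move=> [hc [M hM]]; split.
  by move=> x; apply: continuous_max; [exact: hc|exact: cvg_cst].
exists M => x; have := hM x; rewrite maxEle; case: ifPn => // _.
by rewrite normr0; apply: le_trans.
Qed.

Definition beta_avg (p q : R) (h : R -> R) (x : R) :=
  \int[mu]_(v in `[0, 1]) (beta_kernel p q v * h (x * v)).

(** Euler's B(q + 1, p + 1). It is the total mass of the weight in [beta_avg], which is not
    normalised. *)
Definition beta (p q : R) := \int[mu]_(v in `[0, 1]) beta_kernel p q v.

Variables (p q : R).
Hypotheses (p_range : -1 < p <= 0) (q_range : -1 < q <= 0).

Lemma measurable_beta_avg (h : R -> R) (x : R) (D : set R) : continuous h ->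
  measurable_fun D (fun v => beta_kernel p q v * h (x * v)).
Proof.
move=> hc; apply: measurable_funM; first exact: measurable_beta_kernel.
apply: measurable_funTS; apply: (measurableT_comp (f := h)).
  exact: continuous_measurable_fun.
exact: measurable_funM.
Qed.

Lemma integrable_beta_avg (h : R -> R) (x : R) : bounded_continuous h ->
  mu.-integrable `[0, 1] (EFin \o (fun v => beta_kernel p q v * h (x * v))).
Proof.
move=> [hc [M hM]].
apply: (@le_integrable _ _ _ mu _ _ _
  (fun v => M%:E * (beta_kernel p q v)%:E)%E) => //.
- by apply/measurable_EFinP; exact: measurable_beta_avg.
- move=> v _; rewrite lee_fin /= !normrM mulrC ler_wpM2r//.
  by rewrite (le_trans (hM _))// ler_norm.
- by apply: integrableZl => //; exact: integrable_beta_kernel.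
Qed.

Lemma le_normr_beta_avg (h g : R -> R) (x : R) :
  bounded_continuous h ->
  mu.-integrable `[0, 1] (EFin \o g) ->
  (forall v, 0 <= v <= 1 -> beta_kernel p q v * `|h (x * v)| <= g v) ->
  `|beta_avg p q h x| <= \int[mu]_(v in `[0, 1]) g v.
Proof.
move=> hb gi hg; have hi := integrable_beta_avg h x hb.
rewrite (le_trans (le_normr_Rintegral _ hi))//.
apply: le_Rintegral => //.
  by have := integrable_norm hi; apply.
move=> v; rewrite /= in_itv/= => /hg; apply: le_trans.
by rewrite normrM (ger0_norm (beta_kernel_ge0 _ _ _)).
Qed.

Lemma continuous_beta_avg (h : R -> R) : bounded_continuous h ->
  continuous (beta_avg p q h).
Proof.
move=> hb x; have [hc [M hM]] := hb.
apply: (@continuity_under_integral R _ _ mu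
    (fun y v => beta_kernel p q v * h (y * v)) `[0, 1]%classic _ (x - 1) (x + 1)
    _ _ (fun v => M * beta_kernel p q v)) => //.
- by move=> y _; exact: integrable_beta_avg.
- apply: aeW => v _ y _; apply: cvgM; first exact: cvg_cst.
  apply: (@continuous_comp _ _ _ (fun y : R => y * v) h); last exact: hc.
  by apply: cvgM; [exact: cvg_id|exact: cvg_cst].
- have : mu.-integrable `[0, 1] (fun v => M%:E * (beta_kernel p q v)%:E)%E.
    by apply: integrableZl => //; exact: integrable_beta_kernel.
  by apply: eq_integrable.
- move=> y _; apply: aeW => v _.
  by rewrite normrM mulrC (ger0_norm (beta_kernel_ge0 _ _ _)) ler_wpM2r ?beta_kernel_ge0.
- by rewrite inE/= in_itv/= gtrBl ltrDl ltr01.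
Qed.

Lemma beta_avgB (h k : R -> R) (x : R) :
  bounded_continuous h -> bounded_continuous k ->
  beta_avg p q (fun y => h y - k y) x = beta_avg p q h x - beta_avg p q k x.
Proof.
move=> hb kb; rewrite /beta_avg -RintegralB//; last 2 first.
  exact: integrable_beta_avg.
  exact: integrable_beta_avg.
by apply: eq_Rintegral => v _; rewrite mulrBr.
Qed.

Lemma beta_avgD (h k : R -> R) (x : R) :
  bounded_continuous h -> bounded_continuous k ->
  beta_avg p q (fun y => h y + k y) x = beta_avg p q h x + beta_avg p q k x.
Proof.
move=> hb kb; rewrite /beta_avg -RintegralD//; last 2 first.
  exact: integrable_beta_avg.
  exact: integrable_beta_avg.
by apply: eq_Rintegral => v _; rewrite mulrDr.
Qed.

Lemma beta_avgZ (c : R) (h : R -> R) (x : R) : bounded_continuous h ->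
  beta_avg p q (fun y => c * h y) x = c * beta_avg p q h x.
Proof.
move=> hb; rewrite /beta_avg -RintegralZl//; last exact: integrable_beta_avg.
by apply: eq_Rintegral => v _; rewrite mulrCA.
Qed.

Lemma beta_avg0 (h : R -> R) : beta_avg p q h 0 = h 0 * beta p q.
Proof.
rewrite /beta_avg /beta -RintegralZl//; last exact: integrable_beta_kernel.
by apply: eq_Rintegral => v _; rewrite mul0r mulrC.
Qed.

Lemma beta_avg_cst (c x : R) : beta_avg p q (cst c) x = c * beta p q.
Proof.
rewrite /beta_avg /beta -RintegralZl//; last exact: integrable_beta_kernel.
by apply: eq_Rintegral => v _; rewrite mulrC.
Qed.

(** With nonpositive exponents both factors are at least 1 inside ]0, 1[, which even gives 1 as a
    lower bound. The open interval is used because the kernel may be 0 at the end points. *)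
Lemma beta_gt0 : 0 < beta p q.
Proof.
have ge1 (v r : R) : 0 < v <= 1 -> r <= 0 -> 1 <= v `^ r.
  move=> /andP[v0 v1] r0; have := ler_npowR _ _ _ r0 v0 v1.
  by rewrite powR1.
suff : 1 <= beta p q by apply: lt_le_trans.
have [/andP[p1 p0] /andP[q1 q0]] := (p_range, q_range).
rewrite [leLHS](_ : _ = \int[mu]_(v in `]0, 1[) (cst 1 : R -> R) v); last first.
  rewrite Rintegral_cst//= lebesgue_measure_itv/= lte_fin ltr01.
  by rewrite sube0/= mul1r.
rewrite /beta [leRHS](_ : _ = \int[mu]_(v in `]0, 1[) beta_kernel p q v); last first.
  rewrite /Rintegral integral_itv_bndoo//.
  by apply/measurable_EFinP; exact: measurable_beta_kernel.
apply: le_Rintegral => //.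
- apply: (@integrableS _ _ _ mu `[0, 1]) => //; first exact: subset_itv_oo_cc.
  have := @integrable_powR R 0 1; rewrite ltrN10 ltr01 => /(_ isT isT).
  by apply: eq_integrable => // x _; rewrite /= powRr0.
- apply: (@integrableS _ _ _ mu `[0, 1]) => //.
    exact: subset_itv_oo_cc.
  exact: integrable_beta_kernel.
- move=> v; rewrite /= in_itv/= => /andP[v0 v1].
  by rewrite -[leLHS]mulr1 ler_pM// ge1//; lra.
Qed.

(** The scaling u = x v, where p + q + 1 collects the two exponents and the Jacobian. Up to a factor
    Gamma(p + 1), the left side is the Riemann-Liouville integral of order p + 1 of u^q h(u). *)
Lemma Rintegral_powR_beta_avg (h : R -> R) (x : R) : bounded_continuous h -> 0 < x ->
  \int[mu]_(u in `[0, x]) ((x - u) `^ p * (u `^ q * h u)) =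
  x `^ (p + q + 1) * beta_avg p q h x.
Proof.
move=> hb x0; have [hc _] := hb.
pose G u := (x - u) `^ p * (u `^ q * h u).
have E : \int[mu]_(v in `[0, 1]) (G (x * v) * x) =
    \int[mu]_(u in `[x * 0, x * 1]) G u.
  apply: (@integration_by_substitution_cc R (fun v => x * v) (cst x) G 0 1) => //.
  - by move=> u v _ _ uv; rewrite ltr_pM2l.
  - apply: continuous_subspaceT => v.
    by apply: cvgM; [exact: cvg_cst|exact: cvg_id].
  - move=> v _.
    have := is_deriveZ x (is_derive_id v (1 : R)).
    by rewrite /GRing.scale/= mulr1.
  - by move=> v _; exact: cvg_cst.
  - move=> u; rewrite mulr0 mulr1 => /andP[u0 ux].
    apply: cvgM.
      apply: (@continuous_comp _ _ _ (fun u : R => x - u) (@powR R ^~ p)).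
        by apply: cvgB; [exact: cvg_cst|exact: cvg_id].
      by apply: continuous_powR; rewrite subr_gt0.
    apply: cvgM; first exact: continuous_powR.
    exact: hc.
rewrite mulr0 mulr1 in E; rewrite -E.
have xx : x `^ (p + q + 1) = x `^ p * x `^ q * x.
  by rewrite !powRD ?(gt_eqF x0) ?implybT// powRr1//; exact: ltW.
rewrite /beta_avg -RintegralZl//; last exact: integrable_beta_avg.
apply: eq_Rintegral => v; rewrite inE/= in_itv/= => /andP[v0 v1].
rewrite /G /beta_kernel xx.
have -> : x - x * v = x * (1 - v) by rewrite mulrBr mulr1.
rewrite !powRM ?subr_ge0//; try exact: ltW.
ring.
Qed.

End beta_average.

(** * Composition of complementary Riesz kernels *)

Section semigroup.
Context {R : realType}.
Notation mu := (@lebesgue_measure R).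

Lemma ge0_integral_affine (G : R -> R) (a b : R) : a < b ->
  (forall y, a < y < b -> {for y, continuous G}) -> (forall y, 0 <= G y) ->
  (\int[mu]_(v in `]0%R, 1%R[) (G (a + (b - a) * v) * (b - a))%:E =
   \int[mu]_(s in `]a, b[) (G s)%:E)%E.
Proof.
move=> ab Gc G0; have ba : 0 < b - a by rewrite subr_gt0.
have dF (v : R) : is_derive v 1 (fun v => a + (b - a) * v) (b - a).
  have := is_deriveD (is_derive_cst a v (1 : R))
    (is_deriveZ (b - a) (is_derive_id v (1 : R))).
  by rewrite /GRing.scale/= mulr1 add0r.
have := @ge0_integration_by_substitution_oo R (fun v => a + (b - a) * v)
  (cst (b - a)) G 0 1 ltr01.
rewrite mulr0 addr0 (_ : a + (b - a) * 1 = b); last by ring.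
apply => //.
- by move=> u v _ _ uv; rewrite ltrD2l ltr_pM2l.
- apply: continuous_subspaceT => v.
  apply: cvgD; first exact: cvg_cst.
  by apply: cvgM; [exact: cvg_cst|exact: cvg_id].
- by move=> v _; exact: cvg_cst.
Qed.

Lemma tonelli_triangle (k : R * R -> R) (x : R) :
  measurable_fun setT k -> (forall z, 0 <= k z) ->
  (\int[mu]_(s in `]0%R, x[) \int[mu]_(r in `]0%R, s[) (k (s, r))%:E =
   \int[mu]_(r in `]0%R, x[) \int[mu]_(s in `]r, x[) (k (s, r))%:E)%E.
Proof.
move=> mk k0.
(* Extension by 0 outside the triangle 0 < r < s < x puts both iterated integrals over the full
   plane. *)
pose K (z : R * R) := if [&& 0 < z.2, z.2 < z.1 & z.1 < x] then k z else 0.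
have mK : measurable_fun setT K.
  apply: measurable_fun_ifT => //.
  by do ?apply: measurable_and; apply: measurable_fun_ltr.
have K0 z : (0 <= (K z)%:E)%E by rewrite lee_fin /K; case: ifPn.
have := @fubini_tonelli _ _ _ _ R mu mu (EFin \o K)
  (measurableT_comp (@EFin_measurable R setT) mK) K0.
rewrite /= => FT.
transitivity (\int[mu]_s \int[mu]_r (K (s, r))%:E)%E.
  rewrite integral_mkcond; apply: eq_integral => s _.
  rewrite patchE; case: ifPn => [|].
    rewrite inE/= in_itv/= => /andP[s0 sx].
    rewrite integral_mkcond; apply: eq_integral => r _.
    rewrite patchE /K/= sx andbT; case: ifPn => [|].
      by rewrite inE/= in_itv/= => ->.
    by rewrite notin_setE/= in_itv/= => /negP/negbTE ->.
  rewrite notin_setE/= in_itv/= => sx; rewrite (eq_integral (cst 0%E)).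
    by rewrite integral0.
  move=> r _; rewrite /K/=; case: ifPn => // /and3P[r0 rs s1].
  by exfalso; apply: sx; rewrite (lt_trans r0 rs).
rewrite FT; apply/esym.
rewrite integral_mkcond; apply: eq_integral => r _.
rewrite patchE; case: ifPn => [|].
  rewrite inE/= in_itv/= => /andP[r0 rx].
  rewrite integral_mkcond; apply: eq_integral => s _.
  rewrite patchE /K/= r0/=; case: ifPn => [|].
    by rewrite inE/= in_itv/= => ->.
  by rewrite notin_setE/= in_itv/= => /negP/negbTE ->.
rewrite notin_setE/= in_itv/= => rx; rewrite (eq_integral (cst 0%E)).
  by rewrite integral0.
move=> s _; rewrite /K/=; case: ifPn => // /and3P[r0 rs s1].
by exfalso; apply: rx; rewrite r0 (lt_trans rs).
Qed.

Lemma integrable_powRM (q x : R) (h : R -> R) : -1 < q -> 0 < x ->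
  bounded_continuous h ->
  mu.-integrable `[0, x] (EFin \o (fun u => u `^ q * h u)).
Proof.
move=> q1 x0 [hc [M hM]].
apply: (@le_integrable _ _ _ mu _ _ _ (fun u => M%:E * (u `^ q)%:E)%E) => //.
- apply/measurable_EFinP; apply: measurable_funM.
    by apply: measurable_funTS; exact: measurable_powR.
  by apply: measurable_funTS; exact: continuous_measurable_fun.
- move=> v _; rewrite lee_fin /= !normrM mulrC ler_wpM2r//.
  by rewrite (le_trans (hM _))// ler_norm.
- by apply: integrableZl => //; exact: integrable_powR.
Qed.

Variables (p p' q : R).
Hypotheses (p_range : -1 < p <= 0) (p'_range : -1 < p' <= 0)
  (q_range : -1 < q <= 0) (pp' : p + p' = -1).

(** In the variable v = (s - r) / (x - r) the powers of x - r and the Jacobian combine to (x - r)^(p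
    + p' + 1) = 1. This independence of r and x is what lets the composed kernels reduce to plain
    integration. *)
Lemma ge0_integral_beta_affine (r x : R) : r < x ->
  (\int[mu]_(s in `]r, x[) ((x - s) `^ p' * (s - r) `^ p)%:E =
   (beta p' p)%:E)%E.
Proof.
move=> rx; have xr : 0 < x - r by rewrite subr_gt0.
rewrite -(@ge0_integral_affine (fun s => (x - s) `^ p' * (s - r) `^ p))//.
- transitivity (\int[mu]_(v in `]0%R, 1%R[) (beta_kernel p' p v)%:E)%E; last first.
    rewrite -(@integral_itv_bndoo R 0 1 _ true false); last first.
      by apply/measurable_EFinP; exact: measurable_beta_kernel.
    rewrite /beta /Rintegral fineK//.
    exact/integrable_fin_num/integrable_beta_kernel.
  apply: eq_integral => v; rewrite inE/= in_itv/= => /andP[v0 v1]; congr EFin.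
  have -> : x - (r + (x - r) * v) = (x - r) * (1 - v) by ring.
  have -> : r + (x - r) * v - r = (x - r) * v by ring.
  rewrite !powRM ?subr_ge0 ?(ltW xr) ?ltW//.
  have e : (x - r) `^ p' * (x - r) `^ p * (x - r) = 1.
    rewrite -[X in _ * X]powRr1 ?(ltW xr)// -!powRD ?(gt_eqF xr) ?implybT//.
    by rewrite [p' + p]addrC pp' addNr powRr0.
  rewrite /beta_kernel -[RHS]mul1r -e; ring.
- move=> s /andP[rs sx]; apply: cvgM.
    apply: (@continuous_comp _ _ _ (fun u : R => x - u) (@powR R ^~ p')).
      by apply: cvgB; [exact: cvg_cst|exact: cvg_id].
    by apply: continuous_powR; rewrite subr_gt0.
  apply: (@continuous_comp _ _ _ (fun u : R => u - r) (@powR R ^~ p)).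
    by apply: cvgB; [exact: cvg_id|exact: cvg_cst].
  by apply: continuous_powR; rewrite subr_gt0.
- by move=> s; rewrite mulr_ge0// powR_ge0.
Qed.

Lemma ge0_integral_powR_beta_avg (h : R -> R) (s : R) :
  bounded_continuous h -> (forall u, 0 <= h u) -> 0 < s ->
  (\int[mu]_(r in `]0%R, s[) ((s - r) `^ p * (r `^ q * h r))%:E =
   (s `^ (p + q + 1) * beta_avg p q h s)%:E)%E.
Proof.
move=> hb h0 s0; have [hc _] := hb.
rewrite -(@ge0_integral_affine (fun r => (s - r) `^ p * (r `^ q * h r)))//.
- have ss : s `^ (p + q + 1) = s `^ p * s `^ q * s.
    by rewrite !powRD ?(gt_eqF s0) ?implybT// powRr1//; exact: ltW.
  transitivity (\int[mu]_(v in `]0%R, 1%R[) ((s `^ (p + q + 1))%:E *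
      (beta_kernel p q v * h (s * v))%:E))%E; last first.
    rewrite -(@integral_itv_bndoo R 0 1 _ true false); last first.
      apply: measurable_funeM; apply/measurable_EFinP.
      exact: measurable_beta_avg.
    rewrite integralZl//; last exact: integrable_beta_avg.
    rewrite EFinM /beta_avg /Rintegral fineK//.
    exact/integrable_fin_num/integrable_beta_avg.
  apply: eq_integral => v; rewrite inE/= in_itv/= => /andP[v0 v1]; rewrite -EFinM; congr EFin.
  rewrite ss add0r !subr0 /beta_kernel.
  have -> : s - s * v = s * (1 - v) by ring.
  rewrite !powRM ?subr_ge0 ?(ltW s0) ?ltW//; ring.
- move=> r /andP[r0 rs]; apply: cvgM.
    apply: (@continuous_comp _ _ _ (fun u : R => s - u) (@powR R ^~ p)).
      by apply: cvgB; [exact: cvg_cst|exact: cvg_id].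
    by apply: continuous_powR; rewrite subr_gt0.
  by apply: cvgM; [exact: continuous_powR|exact: hc].
- by move=> r; rewrite !mulr_ge0 ?powR_ge0.
Qed.

(** The average is unfolded as an integral over r < s; after the exchange of the integrals, the one
    over s is the constant [beta p' p]. *)
Lemma ge0_beta_avg_semigroup (h : R -> R) (x : R) :
  bounded_continuous h -> (forall u, 0 <= h u) -> 0 < x ->
  (\int[mu]_(s in `]0%R, x[)
     ((x - s) `^ p' * (s `^ (p + q + 1) * beta_avg p q h s))%:E =
   (beta p' p * \int[mu]_(r in `[0%R, x]) (r `^ q * h r))%:E)%E.
Proof.
move=> hb h0 x0; have [hc _] := hb.
pose k (z : R * R) := (x - z.1) `^ p' * ((z.1 - z.2) `^ p * (z.2 `^ q * h z.2)).
have mk : measurable_fun setT k.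
  apply: measurable_funM.
    apply: (measurableT_comp (measurable_powR p')); exact: measurable_funB.
  apply: measurable_funM.
    apply: (measurableT_comp (measurable_powR p)); exact: measurable_funB.
  apply: measurable_funM.
    exact: (measurableT_comp (measurable_powR q)).
  apply: (measurableT_comp (f := h)) => //; exact: continuous_measurable_fun.
have k0 z : 0 <= k z by rewrite /k !mulr_ge0 ?powR_ge0.
transitivity (\int[mu]_(s in `]0%R, x[) \int[mu]_(r in `]0%R, s[) (k (s, r))%:E)%E.
  apply: eq_integral => s; rewrite inE/= in_itv/= => /andP[s0 sx].
  rewrite EFinM -ge0_integral_powR_beta_avg//.
  rewrite -ge0_integralZl_EFin ?powR_ge0//.
  - by move=> r _; rewrite lee_fin !mulr_ge0 ?powR_ge0.
  - apply/measurable_EFinP; apply: measurable_funM.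
      apply: measurable_funTS; apply: (measurableT_comp (measurable_powR p)).
      exact: measurable_funB.
    apply: measurable_funM.
      apply: measurable_funTS; exact: measurable_powR.
    apply: measurable_funTS; exact: continuous_measurable_fun.
rewrite tonelli_triangle//.
transitivity (\int[mu]_(r in `]0%R, x[) ((beta p' p)%:E * (r `^ q * h r)%:E))%E.
  apply: eq_integral => r; rewrite inE/= in_itv/= => /andP[r0 rx].
  rewrite -(ge0_integral_beta_affine r x)// muleC.
  rewrite -ge0_integralZl_EFin ?mulr_ge0 ?powR_ge0//.
  - by apply: eq_integral => s _; rewrite /k/= -EFinM; congr EFin; ring.
  - by move=> s _; rewrite lee_fin mulr_ge0 ?powR_ge0.
  - apply/measurable_EFinP; apply: measurable_funM.
      apply: measurable_funTS; apply: (measurableT_comp (measurable_powR p')).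
      exact: measurable_funB.
    apply: measurable_funTS; apply: (measurableT_comp (measurable_powR p)).
    exact: measurable_funB.
have [q1 _] := andP q_range.
have ri := integrable_powRM q x h q1 x0 hb.
rewrite -(@integral_itv_bndoo R 0 x _ true false); last first.
  apply: measurable_funeM; apply/measurable_EFinP.
  apply: measurable_funM; first by apply: measurable_funTS; exact: measurable_powR.
  by apply: measurable_funTS; exact: continuous_measurable_fun.
rewrite integralZl// EFinM; congr (_ * _)%E.
by rewrite /Rintegral fineK//; exact: integrable_fin_num.
Qed.

Lemma beta_avg_semigroup (h : R -> R) (x : R) :
  bounded_continuous h -> 0 < x ->
  \int[mu]_(s in `[0, x])
     ((x - s) `^ p' * (s `^ (p + q + 1) * beta_avg p q h s)) =
   beta p' p * \int[mu]_(r in `[0, x]) (r `^ q * h r).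
Proof.
move=> hb x0; have [q1 _] := andP q_range.
pose h1 u := Num.max (h u) 0; pose h2 u := Num.max (- h u) 0.
have b1 : bounded_continuous h1 by exact: bounded_continuous_max0.
have b2 : bounded_continuous h2.
  apply: bounded_continuous_max0.
  have := bounded_continuousB _ _ (bounded_continuous_cst 0) hb.
  by under eq_fun do rewrite sub0r.
have hE u : h u = h1 u - h2 u.
  rewrite /h1 /h2 !maxEle; case: ifPn => h3; case: ifPn => h4; lra.
have mk (g : R -> R) (D : set R) : bounded_continuous g -> measurable_fun D
    (fun s => (x - s) `^ p' * (s `^ (p + q + 1) * beta_avg p q g s)).
  move=> gb; apply: measurable_funTS; apply: measurable_funM.
    by apply: (measurableT_comp (measurable_powR p')); exact: measurable_funB.
  apply: measurable_funM; first exact: measurable_powR.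
  by apply: continuous_measurable_fun; exact: continuous_beta_avg.
(* An extended integral equal to a finite value also yields integrability, which is needed in order
   to subtract the two parts. *)
have pos (g : R -> R) : bounded_continuous g -> (forall u, 0 <= g u) ->
    mu.-integrable `]0, x[ (EFin \o
      (fun s => (x - s) `^ p' * (s `^ (p + q + 1) * beta_avg p q g s))) /\
    \int[mu]_(s in `]0, x[)
      ((x - s) `^ p' * (s `^ (p + q + 1) * beta_avg p q g s)) =
    beta p' p * \int[mu]_(r in `[0, x]) (r `^ q * g r).
  move=> gb g0; have e := ge0_beta_avg_semigroup g x gb g0 x0.
  split; last by rewrite {1}/Rintegral e.
  apply/integrableP; split; first by apply/measurable_EFinP; exact: mk.
  rewrite [ltLHS](_ : _ = (\int[mu]_(s in `]0%R, x[)
      ((x - s) `^ p' * (s `^ (p + q + 1) * beta_avg p q g s))%:E)%E).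
    by rewrite e ltry.
  apply: eq_integral => s _; rewrite /= ger0_norm// !mulr_ge0 ?powR_ge0//.
  by apply: Rintegral_ge0 => v _; rewrite mulr_ge0// beta_kernel_ge0.
have [i1 e1] : _ /\ _ := pos h1 b1 (fun u => ltac:(by rewrite le_max lexx orbT)).
have [i2 e2] : _ /\ _ := pos h2 b2 (fun u => ltac:(by rewrite le_max lexx orbT)).
transitivity (\int[mu]_(s in `]0, x[)
     ((x - s) `^ p' * (s `^ (p + q + 1) * beta_avg p q h s))).
  rewrite /Rintegral integral_itv_bndoo//.
  by apply/measurable_EFinP; exact: mk.
have -> : \int[mu]_(r in `[0, x]) (r `^ q * h r) =
    \int[mu]_(r in `[0, x]) (r `^ q * h1 r) -
    \int[mu]_(r in `[0, x]) (r `^ q * h2 r).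
  rewrite -RintegralB//; try exact: integrable_powRM.
  by apply: eq_Rintegral => r _; rewrite hE mulrBr.
rewrite mulrBr -e1 -e2 -RintegralB//.
apply: eq_Rintegral => s _.
have -> : h = (fun u => h1 u - h2 u) by apply/funext.
rewrite (beta_avgB p q p_range q_range _ _ _ b1 b2); ring.
Qed.

End semigroup.

(** * The Volterra equation *)

Section clamp.
Context {R : realType}.

Definition clamp (X x : R) := Num.max 0 (Num.min x X).

Lemma clamp_itv (X x : R) : 0 <= X -> 0 <= clamp X x <= X.
Proof.
by move=> X0; rewrite /clamp le_max lexx/= ge_max X0 ge_min lexx orbT.
Qed.

Lemma clamp_id (X x : R) : 0 <= x <= X -> clamp X x = x.
Proof. by move=> /andP[x0 xX]; rewrite /clamp min_l// max_r. Qed.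

Lemma continuous_clamp (X : R) : continuous (clamp X).
Proof.
move=> x; apply: (@continuous_max _ _ (cst 0) (fun x => Num.min x X)).
  exact: cvg_cst.
by apply: (@continuous_min _ _ id (cst X)); [exact: cvg_id|exact: cvg_cst].
Qed.

Lemma bounded_continuous_clamp (X : R) (g : R -> R) : 0 <= X ->
  {within `[0, X], continuous g} -> bounded_continuous (g \o clamp X).
Proof.
move=> X0 gc; split.
  move=> x; apply: (@cvg_comp _ _ _ (clamp X) g _
    (within `[0, X]%classic (nbhs (clamp X x)))).
    move=> A hA; apply: (@filterS _ (nbhs x) _ _ _ _ (continuous_clamp X x _ hA)).
    by move=> y /=; apply; rewrite in_itv/=; exact: clamp_itv.
  have /subspace_continuousP := gc; apply.
  by rewrite /= in_itv/=; exact: clamp_itv.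
have [c _ hc] := EVT_max X0 gc.
have [d _ hd] := EVT_min X0 gc.
exists (Num.max `|g c| `|g d|) => x /=.
have xi : clamp X x \in `[0, X] by rewrite in_itv/=; exact: clamp_itv.
have h1 := hc _ xi; have h2 := hd _ xi; rewrite le_max.
have [t0|t0] := ler0P (g (clamp X x)).
  by rewrite -[`|g d|]normrN (le_trans _ (ler_norm (- g d))) ?orbT// lerN2.
by rewrite (le_trans h1)// ler_norm.
Qed.

End clamp.

(** * Fixed points of a contraction for a weighted supremum norm *)

Section weighted_contraction.
Context {R : realType}.
Variables (X W : R) (w : R -> R) (T : (R -> R) -> R -> R).
Hypotheses (X_ge0 : 0 <= X) (w_ge1 : forall x, 0 <= x <= X -> 1 <= w x)
  (w_le : forall x, 0 <= x <= X -> w x <= W)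
  (T_bounded_continuous : forall h, bounded_continuous h ->
     bounded_continuous (T h))
  (T_clamp : forall h x, T h (clamp X x) = T h x)
  (T_contraction : forall h k D, bounded_continuous h -> bounded_continuous k ->
     0 <= D -> (forall x, 0 <= x <= X -> `|h x - k x| <= D * w x) ->
     forall x, 0 <= x <= X -> `|T h x - T k x| <= D / 2 * w x).

(** The weighted norm is never formed: a bound by [D * w] plays its role, and n applications of
    [T_contraction] divide the initial bound by 2^n. *)
Lemma weighted_contraction_unique (h k : R -> R) :
  bounded_continuous h -> bounded_continuous k ->
  (forall x, 0 <= x <= X -> h x = T h x) ->
  (forall x, 0 <= x <= X -> k x = T k x) ->
  forall x, 0 <= x <= X -> h x = k x.
Proof.
move=> hb kb hT kT x xX.
have [_ [M hM]] := bounded_continuousB _ _ hb kb.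
have M0 : 0 <= M by exact: le_trans (hM 0).
have H n y : 0 <= y <= X -> `|h y - k y| <= M / 2 ^+ n * w y.
  elim: n y => [|n IH] y yX.
    rewrite expr0 divr1 (le_trans (hM y))//.
    by rewrite -[leLHS]mulr1 ler_wpM2l// w_ge1.
  rewrite hT// kT// exprSr invfM mulrA.
  by apply: T_contraction => //; rewrite divr_ge0// exprn_ge0.
apply/eqP; rewrite -subr_eq0 -normr_le0.
have lim0 : (fun n => M / 2 ^+ n * w x) @ \oo --> (0 : R).
  have -> : (fun n => M / 2 ^+ n * w x) = geometric (M * w x) 2^-1.
    by apply/funext => n; rewrite /geometric/= exprVn mulrAC.
  by apply: cvg_geometric; rewrite ger0_norm// invf_lt1// ltr1n.
by apply: (cvgr_to_ge lim0); apply: nearW => n; exact: H.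
Qed.

Let picard (n : nat) := iter n T (cst 0).

(** By [T_clamp] the Picard iterates take no other values than those on [0, X]. The weighted
    estimates there, with w at most W, thus give uniform convergence on the whole line, and the
    limit is again bounded and continuous. *)
Lemma weighted_contraction_fixpoint :
  exists2 h, bounded_continuous h & forall x, 0 <= x <= X -> h x = T h x.
Proof.
have pb n : bounded_continuous (picard n).
  elim: n => [|n IH]; first exact: bounded_continuous_cst.
  exact: T_bounded_continuous.
have pcl n x : picard n (clamp X x) = picard n x.
  by case: n => [//|n]; exact: T_clamp.
have [_ [D hD]] := pb 1%N.
have D0 : 0 <= D by exact: le_trans (hD 0).
have W0 : 0 <= W.
  have X0 : 0 <= (0 : R) <= X by rewrite lexx.
  by rewrite (le_trans _ (w_le _ X0))// (le_trans _ (w_ge1 _ X0)).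
have step n x : 0 <= x <= X ->
    `|picard n.+1 x - picard n x| <= D / 2 ^+ n * w x.
  elim: n x => [|n IH] x xX.
    rewrite expr0 divr1 subr0 (le_trans (hD x))//.
    by rewrite -[leLHS]mulr1 ler_wpM2l// w_ge1.
  rewrite exprSr invfM mulrA.
  by apply: (T_contraction _ _ _ (pb n.+1) (pb n)) => //; rewrite divr_ge0// exprn_ge0.
pose C := D * W.
have stepC n x : `|picard n.+1 x - picard n x| <= C / 2 ^+ n.
  rewrite -pcl -(pcl n); have xX := clamp_itv X x X_ge0.
  rewrite (le_trans (step _ _ xX))// /C [D * W / _]mulrAC.
  by rewrite ler_wpM2l ?w_le// divr_ge0// exprn_ge0.
(* The exact partial sum of the geometric series is kept so that the induction on m closes; [tail']
   then forgets the subtracted term. *)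
have tail n m x : `|picard (n + m)%N x - picard n x| <=
    2 * C / 2 ^+ n - 2 * C / 2 ^+ (n + m).
  elim: m => [|m IH]; first by rewrite addn0 !subrr normr0.
  rewrite addnS (le_trans (ler_distD (picard (n + m)%N x) _ _))//.
  rewrite (le_trans (lerD (stepC _ _) IH))// exprS invfM.
  set e := (2 ^+ (n + m))^-1; set d := (2 ^+ n)^-1; lra.
have C0 : 0 <= C by rewrite mulr_ge0.
have tail' n m x : `|picard (n + m)%N x - picard n x| <= 2 * C / 2 ^+ n.
  rewrite (le_trans (tail _ _ _))// gerBl divr_ge0// ?exprn_ge0// mulr_ge0//.
have lim0 : (fun n => 2 * C / 2 ^+ n) @ \oo --> (0 : R).
  have -> : (fun n => 2 * C / 2 ^+ n) = geometric (2 * C) 2^-1.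
    by apply/funext => n; rewrite /geometric/= exprVn.
  by apply: cvg_geometric; rewrite ger0_norm// invf_lt1// ltr1n.
have cv x : cvg (picard n x @[n --> \oo]).
  apply/cauchy_cvgP; apply: cauchy_exP => e e0.
  have /cvgrPdist_lt/(_ e e0)[N _ hN] := lim0.
  exists (picard N x); exists N => // n /= Nn.
  have := hN N (leqnn N); rewrite sub0r normrN ger0_norm; last first.
    by rewrite divr_ge0// ?exprn_ge0// mulr_ge0.
  by apply: le_lt_trans; rewrite distrC -(subnKC Nn); exact: tail'.
pose h x := lim (picard n x @[n --> \oo]).
have hp n x : `|h x - picard n x| <= 2 * C / 2 ^+ n.
  have hc : picard (n + m)%N x @[m --> \oo] --> h x.
    apply: (@cvg_comp _ _ _ (addn n) (fun m => picard m x) _ \oo).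
      exact: cvg_addnl.
    exact: cv.
  have hn : `|picard (n + m)%N x - picard n x| @[m --> \oo] --> `|h x - picard n x|.
    by apply: cvg_norm; apply: cvgB hc _; exact: cvg_cst.
  by apply: (cvgr_to_le hn); apply: nearW => m; exact: tail'.
have hb : bounded_continuous h.
  split.
    move=> x; apply/cvgrPdist_le => e e0.
    have e3 : 0 < e / 3 by rewrite divr_gt0.
    have /cvgrPdist_lt/(_ _ e3)[N _ hN] := lim0.
    have {hN} : 2 * C / 2 ^+ N < e / 3.
      have := hN N (leqnn N); rewrite sub0r normrN ger0_norm//.
      by rewrite divr_ge0// ?exprn_ge0// mulr_ge0.
    move=> hN; have [pc _] := pb N.
    have /cvgrPdist_le/(_ _ e3) := pc x; apply: filterS => y hy.
    have h1 := hp N x; have h2 := hp N y.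
    have -> : h x - h y = (h x - picard N x) + (picard N x - picard N y) -
        (h y - picard N y).
      by ring.
    rewrite (le_trans (ler_normB _ _))// (le_trans (lerD (ler_normD _ _) h2))//.
    rewrite (le_trans (lerD (lerD h1 hy) (lexx _)))//; lra.
  exists (2 * C) => x; have := hp 0%N x.
  by rewrite /picard/= subr0 expr0 divr1.
exists h => // x xX.
apply/eqP; rewrite -subr_eq0 -normr_le0.
(* Both terms are compared with [picard n.+1 x], which is [T (picard n) x]: the contraction controls
   one distance, the speed of convergence the other. *)
have H n : `|h x - T h x| <= 2 * C / 2 ^+ n * (1 + w x).
  have h2 : `|T h x - T (picard n) x| <= 2 * C / 2 ^+ n / 2 * w x.
    apply: T_contraction => // [|y yX].
      by rewrite divr_ge0// ?exprn_ge0// mulr_ge0.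
    rewrite (le_trans (hp n y))// -[leLHS]mulr1 ler_wpM2l// ?w_ge1//.
    by rewrite divr_ge0// ?exprn_ge0// mulr_ge0.
  have h1 := hp n.+1 x.
  rewrite distrC (le_trans (ler_distD (picard n.+1 x) _ _))//.
  rewrite [X in _ + X]distrC (le_trans (lerD h2 h1))// exprS invfM.
  set e := (2 ^+ n)^-1; have e0 : 0 <= 2 * C * e.
    by rewrite !mulr_ge0// invr_ge0 exprn_ge0.
  have -> : 2 * C * (2^-1 * e) = 2 * C * e / 2 by ring.
  rewrite mulrDr mulr1 addrC lerD//.
    by rewrite ler_pdivrMr// ler_peMr// ler1n.
  rewrite ler_wpM2r//; last by rewrite ler_pdivrMr// ler_peMr// ler1n.
  by rewrite (le_trans ler01)// w_ge1.
have lim1 : (2 * C / 2 ^+ n * (1 + w x)) @[n --> \oo] --> (0 : R).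
  by rewrite -(mul0r (1 + w x)); apply: cvgM lim0 _; exact: cvg_cst.
by apply: (cvgr_to_ge lim1); apply: nearW => n; exact: H.
Qed.

End weighted_contraction.

(** * The contraction estimate for the Volterra operator *)

Section volterra.
Context {R : realType}.
Notation mu := (@lebesgue_measure R).

(** In logarithmic form this is a ln w <= w, which follows from ln w <= w if ln w >= 0 and from the
    signs otherwise. *)
Lemma expRN_le_powR (w a : R) : 0 < w -> 0 <= a <= 1 -> expR (- w) <= w `^ (- a).
Proof.
move=> w0 /andP[a0 a1]; rewrite expRN powRN lef_pV2 ?posrE ?expR_gt0 ?powR_gt0//.
rewrite /powR gt_eqF// ler_expR.
have lw : ln w <= w by rewrite ltW// ln_sublinear.
have [l0|l0] := leP 0 (ln w).
  by rewrite (le_trans _ lw)// ler_piMl.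
by rewrite (le_trans _ (ltW w0))// mulr_ge0_le0// ltW.
Qed.

Variables (alpha X L c0 k0 : R) (N : (R -> R) -> R -> R).
Hypotheses (alpha_range : 0 < alpha < 1) (X_gt0 : 0 < X) (L_ge0 : 0 <= L)
  (N_bounded_continuous : forall h, bounded_continuous h ->
     bounded_continuous (N h))
  (N_lipschitz : forall h k, bounded_continuous h -> bounded_continuous k ->
     forall x, 0 < x <= X -> `|N h x - N k x| <= L * `|h x - k x|).

Let a1 := alpha - 1.
Let a1_range : -1 < a1 <= 0.
Proof. by rewrite /a1; case/andP: alpha_range => h1 h2; apply/andP; split; lra. Qed.

(** The exponent alpha - 1 of 1 - v once it has absorbed (1 - v)^(-alpha/2). Spending half of alpha
    keeps it above -1, and leaves a positive power of x as well. *)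
Let a2 := alpha / 2 - 1.
Let a2_range : -1 < a2 <= 0.
Proof. by rewrite /a2; case/andP: alpha_range => h1 h2; apply/andP; split; lra. Qed.

Definition volterra (h : R -> R) (x : R) :=
  c0 + k0 * (x `^ alpha * beta_avg (alpha - 1) (alpha - 1) (N h) x).

(** The weight splits as exp(K x v) = exp(K x) exp(-w) with w = K x (1 - v). In the bound
    w^(-alpha/2), the factor in 1 - v goes into the kernel, the factor in x is compensated by
    x^alpha, and the factor in K is the gain. *)
Lemma volterra_weight (K D : R) (h k : R -> R) : 0 < K -> 0 <= D ->
  bounded_continuous h -> bounded_continuous k ->
  (forall x, 0 <= x <= X -> `|h x - k x| <= D * expR (K * x)) ->
  forall x, 0 <= x <= X -> `|volterra h x - volterra k x| <=
    D * (`|k0| * L * beta a2 a1 * X `^ (alpha / 2)) * K `^ (- (alpha / 2)) *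
    expR (K * x).
Proof.
move=> K0 D0 hb kb hk x /andP[x0 xX].
have [al0 al1] := andP alpha_range.
have -> : volterra h x - volterra k x =
    k0 * (x `^ alpha * beta_avg a1 a1 (fun y => N h y - N k y) x).
  have Nh := N_bounded_continuous _ hb; have Nk := N_bounded_continuous _ kb.
  by rewrite (beta_avgB _ _ a1_range a1_range _ _ _ Nh Nk) /volterra -/a1; ring.
move: x0; rewrite le_eqVlt => /predU1P[<-|x0].
  rewrite powR0 ?(gt_eqF al0)// mul0r mulr0 normr0.
  by rewrite !mulr_ge0 ?powR_ge0 ?expR_ge0// ltW// beta_gt0.
have Kx0 : 0 < K * x by rewrite mulr_gt0.
pose c := L * D * expR (K * x) * (K * x) `^ (- (alpha / 2)).
have c_ge0 : 0 <= c by rewrite /c !mulr_ge0 ?powR_ge0 ?expR_ge0.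
have main : `|beta_avg a1 a1 (fun y => N h y - N k y) x| <= c * beta a2 a1.
  rewrite /beta -RintegralZl//; last exact: integrable_beta_kernel.
  apply: le_normr_beta_avg => //.
  - by apply: bounded_continuousB; exact: N_bounded_continuous.
  - have : mu.-integrable `[0, 1] (fun v => c%:E * (beta_kernel a2 a1 v)%:E)%E.
      by apply: integrableZl => //; exact: integrable_beta_kernel.
    by apply: eq_integrable.
  - move=> v /andP[v0 v1].
    have a10 : a1 != 0 by rewrite /a1 lt_eqF// subr_lt0.
    have a20 : a2 != 0 by rewrite /a2 lt_eqF//; lra.
    (* The Lipschitz bound asks for x v > 0 and the exponential bound for v < 1; at the two end
       points the kernels are 0 by the convention on powers of 0. *)
    move: v0; rewrite le_eqVlt => /predU1P[<-|v0].
      by rewrite /beta_kernel (powR0 a10) !(mulr0, mul0r).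
    move: v1; rewrite le_eqVlt => /predU1P[->|v1].
      by rewrite /beta_kernel subrr (powR0 a10) (powR0 a20) !(mulr0, mul0r).
    have xv0 : 0 < x * v by rewrite mulr_gt0.
    have xvX : x * v <= X by rewrite (le_trans _ xX)// ger_pMr// ltW.
    have v10 : 0 < 1 - v by rewrite subr_gt0.
    have h1 : `|N h (x * v) - N k (x * v)| <= L * (D * expR (K * (x * v))).
      rewrite (le_trans (N_lipschitz _ _ hb kb _ _)) ?xv0//.
      by rewrite ler_wpM2l// hk// xvX ltW.
    have h2 : expR (K * (x * v)) <=
        expR (K * x) * ((K * x) `^ (- (alpha / 2)) * (1 - v) `^ (- (alpha / 2))).
      have -> : K * (x * v) = K * x + - (K * x * (1 - v)) by ring.
      rewrite expRD ler_wpM2l ?expR_ge0// -powRM ?(ltW Kx0) ?(ltW v10)//.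
      apply: expRN_le_powR; first by rewrite mulr_gt0.
      by apply/andP; split; lra.
    have h3 : beta_kernel a2 a1 v = beta_kernel a1 a1 v * (1 - v) `^ (- (alpha / 2)).
      rewrite /beta_kernel mulrAC -powRD ?(gt_eqF v10) ?implybT//.
      by congr (_ `^ _ * _); rewrite /a1 /a2; field.
    rewrite h3 mulrCA ler_wpM2l ?beta_kernel_ge0//.
    rewrite (le_trans h1)// /c -!mulrA ler_wpM2l// ler_wpM2l//.
(* Half of x^alpha pays for x^(-alpha/2), and the other half is at most X^(alpha/2). *)
have h4 : x `^ alpha * (K * x) `^ (- (alpha / 2)) <=
    X `^ (alpha / 2) * K `^ (- (alpha / 2)).
  rewrite powRM ?(ltW K0) ?(ltW x0)// mulrCA mulrC ler_wpM2r ?powR_ge0//.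
  rewrite -powRD ?(gt_eqF x0) ?implybT//.
  have -> : alpha + - (alpha / 2) = alpha / 2 by field.
  by apply: ge0_ler_powR; rewrite ?nnegrE ?(ltW x0) ?(ltW X_gt0)//; lra.
rewrite !normrM (ger0_norm (powR_ge0 _ _)).
have b0 : 0 <= beta a2 a1 by rewrite ltW// beta_gt0.
apply: (@le_trans _ _ (`|k0| * (x `^ alpha * (c * beta a2 a1)))).
  by rewrite !ler_wpM2l ?powR_ge0.
have -> : `|k0| * (x `^ alpha * (c * beta a2 a1)) =
    (`|k0| * L * D * expR (K * x) * beta a2 a1) * (x `^ alpha * (K * x) `^ (- (alpha / 2))).
  by rewrite /c; ring.
have -> : D * (`|k0| * L * beta a2 a1 * X `^ (alpha / 2)) * K `^ (- (alpha / 2)) * expR (K * x)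
  = (`|k0| * L * D * expR (K * x) * beta a2 a1) * (X `^ (alpha / 2) * K `^ (- (alpha / 2))).
  ring.
by rewrite ler_wpM2l// !mulr_ge0 ?expR_ge0.
Qed.

Lemma volterra_clamp_bounded_continuous (h : R -> R) :
  bounded_continuous h -> bounded_continuous (volterra h \o clamp X).
Proof.
move=> hb; have [al0 al1] := andP alpha_range.
apply: bounded_continuous_clamp; first exact: ltW.
move=> x; apply: cvgD; first exact: cvg_cst.
apply: cvgM; first exact: cvg_cst.
apply: cvgM; first exact: within_continuous_powR.
apply: continuous_subspaceT.
by apply: continuous_beta_avg => //; exact: N_bounded_continuous.
Qed.

Lemma volterra_solution :
  exists2 h, bounded_continuous h &
    (forall x, 0 <= x <= X -> h x = volterra h x) /\
    (forall k, bounded_continuous k ->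
      (forall x, 0 <= x <= X -> k x = volterra k x) ->
      forall x, 0 <= x <= X -> k x = h x).
Proof.
have [al0 al1] := andP alpha_range.
pose M := `|k0| * L * beta a2 a1 * X `^ (alpha / 2).
have M0 : 0 <= M by rewrite /M !mulr_ge0 ?powR_ge0// ltW// beta_gt0.
(* With this choice K^(-alpha/2) = 1 / (2 M + 1), so that the contraction factor M / (2 M + 1) is at
   most 1/2. *)
pose K := (2 * M + 1) `^ (2 / alpha).
have M1 : 0 < 2 * M + 1 by lra.
have K0 : 0 < K by rewrite powR_gt0.
have KM : M * K `^ (- (alpha / 2)) <= 2^-1.
  rewrite /K -powRrM.
  have -> : 2 / alpha * - (alpha / 2) = -1 by field; rewrite gt_eqF.
  rewrite (powR_inv1 (ltW M1)) (ler_pdivrMr _ _ M1); lra.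
pose T h := volterra h \o clamp X.
have X0 := ltW X_gt0.
have Tcl h x : T h (clamp X x) = T h x by rewrite /T /= (clamp_id X (clamp X x))// clamp_itv.
have TE h x : 0 <= x <= X -> T h x = volterra h x by move=> xX; rewrite /T/= clamp_id.
have Tb h : bounded_continuous h -> bounded_continuous (T h).
  exact: volterra_clamp_bounded_continuous.
pose w x := expR (K * x).
have w1 x : 0 <= x <= X -> 1 <= w x.
  by move=> /andP[x0 _]; rewrite /w -expR0 ler_expR mulr_ge0// ltW.
have wW x : 0 <= x <= X -> w x <= expR (K * X).
  by move=> /andP[_ xX]; rewrite /w ler_expR ler_wpM2l// ltW.
have Tc h k D : bounded_continuous h -> bounded_continuous k -> 0 <= D ->
    (forall x, 0 <= x <= X -> `|h x - k x| <= D * w x) ->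
    forall x, 0 <= x <= X -> `|T h x - T k x| <= D / 2 * w x.
  move=> hb kb D0 hk x xX; rewrite !TE//.
  rewrite (le_trans (volterra_weight _ _ _ _ K0 D0 hb kb hk _ xX))//.
  by rewrite ler_wpM2r ?expR_ge0// -mulrA ler_wpM2l.
have [h hb hT] := weighted_contraction_fixpoint X _ w T X0 w1 wW Tb Tcl Tc.
exists h => //; split => [x xX|k kb kT]; first by rewrite hT// TE.
apply: (weighted_contraction_unique X w T w1 Tc) => // x xX.
by rewrite TE//; exact: kT.
Qed.

End volterra.

(** * The theorem of Goldowsky and Tonelli *)

Section goldowsky_tonelli.
Context {R : realType}.
Notation mu := (@lebesgue_measure R).

(** Let c be the supremum of the points up to which the bound holds. The local bound centred at c is
    used twice: to the left it shows that c is reached, taking the place of continuity, and to the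
    right it goes beyond c unless c = b. *)
Lemma increment_le_local (g phi : R -> R) (a b : R) : a <= b ->
  {in `[a, b] &, {homo phi : s t / s <= t}} ->
  (forall c, a <= c <= b -> exists2 d, 0 < d & forall t, a <= t <= b ->
     `|t - c| < d -> `|g t - g c| <= `|phi t - phi c|) ->
  `|g b - g a| <= phi b - phi a.
Proof.
move=> ab phi_nd loc.
pose S := [set t | a <= t <= b /\ `|g t - g a| <= phi t - phi a].
have Sa : S a by split; rewrite ?lexx// !subrr normr0.
have Sb : ubound S b by move=> t [/andP[]].
have hS : has_sup S by split; [exists a|exists b].
set c := sup S.
have ac : a <= c by apply: sup_upper_bound.
have cb : c <= b by apply: sup_le_ub => //; exists a.
have cab : a <= c <= b by rewrite ac cb.
have [d d0 hd] := loc _ cab.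
have mono s t : a <= s -> s <= t -> t <= b -> `|phi t - phi s| = phi t - phi s.
  move=> h1 h2 h3; rewrite ger0_norm// subr_ge0 phi_nd// in_itv/=.
    by rewrite h1 (le_trans h2).
  by rewrite h3 (le_trans h1).
have Sc : S c.
  have [t St ct] := sup_adherent d0 hS.
  have [/andP[at_ tb] ht] := St.
  have tc : t <= c by apply: sup_upper_bound.
  split=> //.
  have h1 : `|g t - g c| <= phi c - phi t.
    rewrite -(mono t c)// distrC [leRHS]distrC distrC hd ?at_//.
    by rewrite distrC ger0_norm ?subr_ge0// ltrBlDl -ltrBlDr.
  rewrite (le_trans (ler_distD (g t) _ _))// distrC.
  by rewrite (le_trans (lerD h1 ht))// addrA subrK.
have [bc|] := leP b c.
  by have cbE : c = b; [apply/eqP; rewrite eq_le cb|have [_] := Sc; rewrite cbE].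
move=> cltb; exfalso.
pose t := Num.min b (c + d / 2).
have ct : c < t by rewrite lt_min cltb ltrDl divr_gt0.
have tb : t <= b by rewrite ge_min lexx.
have tcd : t <= c + d / 2 by rewrite ge_min lexx orbT.
have tab : a <= t <= b by rewrite tb (le_trans ac (ltW ct)).
have St : S t.
  split=> //; have [_ h2] := Sc.
  have h1 := hd _ tab; rewrite mono// in h1; last exact: ltW.
  rewrite (le_trans (ler_distD (g c) _ _))//.
  rewrite (le_trans (lerD (h1 _) h2)) ?addrA ?subrK//.
  rewrite ger0_norm ?subr_ge0 ?(ltW ct)//; lra.
have : t <= c by apply: sup_upper_bound.
by rewrite leNgt ct.
Qed.

(* For open sets U k containing an exceptional null set, with
   \sum_k (k + 1) mu (U k) <= e, this function increases by at most e in total,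
   but near an exceptional point its slope is at least k + 1 for every k, which
   dominates any finite derivative. *)
Let cover_weight (U : nat -> set R) (a t : R) : \bar R :=
  (\sum_(k <oo) k.+1%:R%:E * mu (U k `&` `[a, t]%classic))%E.

(** Each measure splits at s, and of the series over ]s, t] only the k-th term is kept, where [U k]
    contains the whole interval. *)
Lemma cover_weight_incr (U : nat -> set R) (a s t : R) (k : nat) :
  (forall k, measurable (U k)) -> a <= s -> s <= t ->
  `]s, t]%classic `<=` U k ->
  (cover_weight U a s + (k.+1%:R * (t - s))%:E <= cover_weight U a t)%E.
Proof.
move=> mU as_ st sU.
have mI n (i : interval R) : measurable (U n `&` [set` i]) by exact: measurableI.
have e n : mu (U n `&` `[a, t]%classic) =
    (mu (U n `&` `[a, s]%classic) + mu (U n `&` `]s, t]%classic))%E.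
  have -> : U n `&` `[a, t]%classic =
      (U n `&` `[a, s]%classic) `|` (U n `&` `]s, t]%classic).
    rewrite -setIUr; congr (_ `&` _); apply/seteqP; split => x /=.
      rewrite !in_itv/= => /andP[-> ->]; rewrite andbT.
      by have [xs|xs] := leP x s; [left|right].
    rewrite !in_itv/= => -[/andP[-> xs]|/andP[sx ->]]; first by rewrite (le_trans xs).
    by rewrite (le_trans as_ (ltW sx)).
  rewrite measureU//; [exact: mI|exact: mI|].
  apply/seteqP; split => // x [[_ /=] + [_ /=]]; rewrite !in_itv/=.
  by move=> /andP[_ xs] /andP[]; rewrite ltNge xs.
rewrite /cover_weight.
under [X in (_ <= X)%E]eq_eseriesr.
  move=> n _; rewrite e ge0_muleDr ?measure_ge0//; over.
rewrite nneseriesD//; last 2 first.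
  by move=> n _; rewrite mule_ge0// ?lee_fin// measure_ge0.
  by move=> n _; rewrite mule_ge0// ?lee_fin// measure_ge0.
rewrite leeD2l//.
rewrite (le_trans _ (nneseries_lim_ge k.+1 _)) => [||]; last first.
  by move=> n _; rewrite mule_ge0// ?lee_fin// measure_ge0.
rewrite big_nat_recr//= -[leLHS]add0e leeD//.
  by apply: sume_ge0 => n _; rewrite mule_ge0// ?lee_fin// measure_ge0.
rewrite setIC (setIidl sU) lebesgue_measure_itv/= EFinM.
rewrite lee_pmul2l//.
case: ifPn => [_|]; first by rewrite EFinB.
by rewrite lte_fin -leNgt => ts; rewrite lee_fin subr_le0.
by [].
Qed.

Lemma eq_ae_derive1_0 (g : R -> R) (a b : R) : a <= b ->
  (forall x, a <= x <= b -> derivable g x 1) ->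
  {ae mu, forall x, a <= x <= b -> derive1 g x = 0} ->
  g a = g b.
Proof.
move=> ab dg [A [mA A0 subA]].
apply/eqP; rewrite eq_sym -subr_eq0 -normr_le0.
apply/ler_addgt0Pr => e0 e00; rewrite add0r.
(* The comparison function [phi] will increase by at most e through the cover weight and by e (b -
   a) through its linear part, that is, by e0 in total. *)
pose e := e0 / (1 + (b - a)).
have ba0 : 0 <= b - a by rewrite subr_ge0.
have e_gt0 : 0 < e by rewrite divr_gt0// ltr_wpDr.
(* The division by k + 1 cancels the coefficient in [cover_weight], and the factors 2^-(k + 1) make
   the series sum to at most e. *)
have Uex k : exists U : set R, [/\ open U, A `<=` U &
    (mu U <= (e / (2 ^ k.+1)%:R / k.+1%:R)%:E)%E].
  have ek : 0 < e / (2 ^ k.+1)%:R / k.+1%:R.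
    by apply: divr_gt0 => //; apply: divr_gt0 => //; rewrite ltr0n expn_gt0.
  have Aoo : (mu A < +oo)%E by rewrite A0 ltry.
  have [U [oU AU mUA]] := lebesgue_regularity_outer mA Aoo ek.
  exists U; split => //.
  have mU : measurable U by exact: open_measurable.
  have UE : (U `\` A) `|` A = U by exact: setDKU.
  have muE : mu ((U `\` A) `|` A) = (mu (U `\` A) + mu A)%E.
    apply: measureU => //; first exact: measurableD.
    by apply/seteqP; split => // x [[]].
  by rewrite UE A0 adde0 in muE; rewrite muE ltW.
have /choice[U hU] := Uex.
have mU k : measurable (U k) by have [oU _ _] := hU k; exact: open_measurable.
have cw0 t : (0 <= cover_weight U a t)%E.
  by apply: nneseries_ge0 => n _ _; rewrite mule_ge0// ?lee_fin// measure_ge0.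
have cwe t : (cover_weight U a t <= e%:E)%E.
  rewrite (le_trans _ (epsilon_trick0 xpredT (ltW e_gt0)))//.
  apply: lee_nneseries => [n _|n _]; first by rewrite mule_ge0// ?lee_fin// measure_ge0.
  have [_ _ hn] := hU n.
  rewrite (@le_trans _ _ (n.+1%:R%:E * mu (U n)))%E//.
    rewrite lee_pmul2l//; apply: le_measure; rewrite ?inE//.
      by apply: measurableI => //; exact: mU.
    exact: mU.
  rewrite (@le_trans _ _ (n.+1%:R%:E * (e / (2 ^ n.+1)%:R / n.+1%:R)%:E)%E)//.
    by rewrite lee_pmul2l.
  by rewrite -EFinM mulrC divfK.
have cwfin t : cover_weight U a t \is a fin_num.
  by rewrite ge0_fin_numE// (le_lt_trans (cwe t))// ltry.
pose om t := fine (cover_weight U a t).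
have om_incr s t k : a <= s -> s <= t -> `]s, t]%classic `<=` U k ->
    k.+1%:R * (t - s) <= om t - om s.
  move=> h1 h2 h3; have := cover_weight_incr U a s t k mU h1 h2 h3.
  rewrite lerBrDl -lee_fin EFinD /om !fineK//.
have om_nd s t : a <= s -> s <= t -> om s <= om t.
  move=> h1 h2; rewrite /om fine_le//; apply: lee_nneseries => n _.
    by rewrite mule_ge0// ?lee_fin// measure_ge0.
  rewrite lee_pmul2l//; apply: le_measure; rewrite ?inE;
    [by apply: measurableI => //; exact: mU..|].
  by apply: setIS; apply: subset_itvl; rewrite bnd_simp.
pose phi t := om t + e * t.
have phi_nd : {in `[a, b] &, {homo phi : s t / s <= t}}.
  move=> s t; rewrite !in_itv/= => /andP[as_ _] _ st.
  by rewrite lerD ?om_nd// ler_wpM2l// ltW.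
have loc c : a <= c <= b -> exists2 d, 0 < d & forall t, a <= t <= b ->
     `|t - c| < d -> `|g t - g c| <= `|phi t - phi c|.
  move=> cab; have [dq dc] := (dg _ cab, erefl (derive1 g c)).
  have quot (r : R) : `|derive1 g c| < r -> exists2 d, 0 < d & forall t,
      `|t - c| < d -> `|g t - g c| <= r * `|t - c|.
    move=> gr; have gd : (fun h => h^-1 *: (g (h *: 1 + c) - g c)) @ 0^' --> derive1 g c.
      by rewrite derive1E; exact: dq.
    have := cvgr_norm_lt _ gd _ gr.
    move=> [d /= d0 hd].
    exists d => // t td.
    have [->|tc] := eqVneq t c; first by rewrite !subrr normr0 mulr0.
    have tc0 : t - c != 0 by rewrite subr_eq0.
    have := hd (t - c); rewrite /ball/= sub0r normrN => /(_ td tc0).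
    rewrite /GRing.scale/= mulr1 subrK normrM normfV mulrC.
    by rewrite ltr_pdivrMr ?normr_gt0// => /ltW.
  have phiE t : a <= t -> `|phi t - phi c| = `|om t - om c| + e * `|t - c|.
    move=> at_; have [ac _] := andP cab; rewrite /phi.
    have [ct|/ltW tc] := leP c t.
      have oct := om_nd _ _ ac ct.
      have h1 : 0 <= e * (t - c) by rewrite mulr_ge0// ?subr_ge0// ltW.
      by rewrite !ger0_norm ?subr_ge0//; lra.
    have otc := om_nd _ _ at_ tc.
    have h1 : 0 <= e * (c - t) by rewrite mulr_ge0// ?subr_ge0// ltW.
    by rewrite !ler0_norm ?subr_le0//; lra.
  have [Ac|nAc] := pselect (A c).
    (* At an exceptional point this k gives |g'(c)| < k + 1, while [om] has slope at least k + 1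
       inside the open set [U k] around c. *)
    pose k := Num.trunc `|derive1 g c|.
    have [d d0 hd] := quot k.+1%:R (truncnS_gt _).
    have [oU AU _] := hU k.
    have [d' /= d'0 hd'] : nbhs c (U k) by apply: open_nbhs_nbhs; split => //; exact: AU.
    exists (Num.min d d'); first by rewrite lt_min d0.
    move=> t /andP[at_ tb]; rewrite lt_min => /andP[td td'].
    rewrite (le_trans (hd t td))// phiE// (@le_trans _ _ `|om t - om c|)//; last first.
      by rewrite lerDl mulr_ge0// ltW.
    have inU s : `|s - c| <= `|t - c| -> U k s.
      by move=> sc; apply: hd'; rewrite /ball/= distrC (le_lt_trans sc).
    have [ac cb] := andP cab; have [ct|/ltW tc] := leP c t.
      have oct := om_nd _ _ ac ct.
      rewrite !ger0_norm ?subr_ge0//; apply: om_incr => // s /=.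
      rewrite in_itv/= => /andP[cs st]; apply: inU.
      by rewrite !ger0_norm ?subr_ge0// ?(ltW cs)// lerD2r.
    have otc := om_nd _ _ at_ tc.
    rewrite !ler0_norm ?subr_le0// !opprB; apply: om_incr => // s /=.
    rewrite in_itv/= => /andP[ts sc]; apply: inU.
    by rewrite !ler0_norm ?subr_le0// !opprB lerD2l lerN2 ltW.
  (* At the other points the derivative is 0, and the linear part of [phi], of slope e, suffices. *)
  have g0 : derive1 g c = 0.
    by apply: contrapT => gc; apply: nAc; apply: subA => /(_ cab).
  have ge : `|derive1 g c| < e by rewrite g0 normr0.
  have [d d0 hd] := quot _ ge.
  exists d => // t /andP[at_ _] td; rewrite (le_trans (hd t td))// phiE//.
  by rewrite lerDr.
rewrite (le_trans (increment_le_local g phi a b ab phi_nd loc))//.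
rewrite /phi.
have : om b <= e by rewrite -lee_fin /om fineK.
have : 0 <= om a by rewrite fine_ge0.
have : e0 = e * (1 + (b - a)) by rewrite /e divfK// gt_eqF// ltr_wpDr.
lra.
Qed.

End goldowsky_tonelli.

(** * Gamma function and derivatives within a set *)

Section gamma.
Context {R : realType}.
Notation mu := (@lebesgue_measure R).

(** An infinite integral would be read as 0, so positivity includes finiteness. The integrand is
    dominated by x^(p - 1) on [0, 1] plus the exponential density, and bounded below by exp(-1) on
    ]0, 1[. *)
Lemma Gamma_gt0 (p : R) : 0 < p <= 1 -> 0 < Gamma p.
Proof.
move=> /andP[p0 p1]; rewrite /Gamma.
have e1 : 1 `^ (p - 1) = 1 by rewrite powR1.
pose f (x : R) := x `^ (p - 1) * expR (- x).
have f0 x : 0 <= f x by rewrite mulr_ge0 ?powR_ge0 ?expR_ge0.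
have mf (D : set R) : measurable_fun D f.
  apply: measurable_funTS; apply: measurable_funM; first exact: measurable_powR.
  by apply: measurableT_comp => //; exact: measurableT_comp.
pose g (x : R) := ((@powR R ^~ (p - 1)) \_ `[0, 1]) x + exponential_pdf 1 x.
have gi : mu.-integrable `]0, +oo[ (EFin \o g).
  have h1 : mu.-integrable `]0, +oo[ (EFin \o ((@powR R ^~ (p - 1)) \_ `[0, 1])).
    apply: (@integrableS _ _ _ mu setT) => //.
    rewrite -restrict_EFin; apply/integrable_restrict => //; rewrite setTI.
    by apply: integrable_powR => //; lra.
  have h2 : mu.-integrable `]0, +oo[ (EFin \o exponential_pdf (1 : R)).
    apply: (@integrableS _ _ _ mu setT) => //.
    exact: integrable_exponential_pdf.
  by apply: eq_integrable (integrableD _ h1 h2).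
have fi : mu.-integrable `]0, +oo[ (EFin \o f).
  apply: (le_integrable _ _ _ gi) => //; first by apply/measurable_EFinP; exact: mf.
  move=> x; rewrite /= in_itv/= andbT => x0; rewrite lee_fin ger0_norm//.
  rewrite (le_trans _ (ler_norm _))// /g patchE (exponential_pdfE _ (ltW x0)).
  rewrite mul1r mulN1r /f.
  have [x1|x1] := leP x 1.
    have -> : x \in `[0, 1]%classic by rewrite inE/= in_itv/= x1 ltW.
    rewrite -[leLHS]addr0 lerD ?expR_ge0// ler_piMr ?powR_ge0//.
    by rewrite -expR0 ler_expR oppr_le0 ltW.
  have -> : (x \in `[0, 1]%classic) = false.
    by apply/negbTE; rewrite notin_setE/= in_itv/= => /andP[_]; rewrite leNgt x1.
  rewrite add0r ler_piMl ?expR_ge0//.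
  by rewrite -[leRHS]e1 ler_npowR//; [lra|exact: ltW].
rewrite fine_gt0//; apply/andP; split; last first.
  by rewrite ltey_eq (integrable_fin_num _ fi).
apply: (@lt_le_trans _ _ (\int[mu]_(x in `]0%R, 1%R[) (expR (- 1))%:E)%E).
  rewrite integral_cst//= lebesgue_measure_itv/= lte_fin ltr01 sube0 mule1.
  by rewrite lte_fin expR_gt0.
apply: (@le_trans _ _ (\int[mu]_(x in `]0%R, 1%R[) (f x)%:E)%E).
  apply: ge0_le_integral => //.
  - by apply/measurable_EFinP; exact: mf.
  - move=> x; rewrite /= in_itv/= => /andP[x0 x1]; rewrite lee_fin.
    rewrite /f -[leLHS]mul1r ler_pM ?expR_ge0//.
      by rewrite -[leLHS]e1 ler_npowR//; [lra|exact: ltW].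
    by rewrite ler_expR lerN2 ltW.
apply: ge0_subset_integral => //.
- by apply/measurable_EFinP; exact: mf.
- by move=> x _; rewrite lee_fin.
- by apply: subset_itvl.
Qed.

End gamma.

(** * Derivatives relative to a set *)

Section derive_within.
Context {R : realType}.
Implicit Types (A : set R) (g F : R -> R) (t : R).

Lemma within_dnbhsE A t (P : set R) :
  within A t^' P = nbhs t (fun s => s != t -> A s -> P s).
Proof. by []. Qed.

Lemma cvg_within_dnbhs A g t : g s @[s --> within A t^'] --> g t ->
  g s @[s --> within A (nbhs t)] --> g t.
Proof.
move=> h U Ut; apply: (@filterS _ (nbhs t) _ _ _ _ (h U Ut)) => s hs As.
by have [->|st] := eqVneq s t; [apply: (@nbhs_singleton R (g t) U); exact: Ut|exact: hs].
Qed.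

Lemma diff_quot_cvg A g t (d : R) :
  (g s - g t) / (s - t) @[s --> within A t^'] --> d ->
  g s @[s --> within A t^'] --> g t.
Proof.
move=> gd.
have h : (g t + (g s - g t) / (s - t) * (s - t)) @[s --> within A t^'] --> g t + d * 0.
  apply: cvgD; first exact: cvg_cst.
  apply: cvgM; first exact: gd.
  rewrite -(subrr t); apply: cvgB; last exact: cvg_cst.
  move=> U Ut; apply: (@filterS _ (nbhs t) _ _ _ _ Ut) => s Us _ _; exact: Us.
rewrite mulr0 addr0 in h; apply: cvg_trans h.
apply: near_eq_cvg; apply: (@filterS _ (nbhs t) _ setT _ _ filterT) => s _ st _ /=.
by rewrite divfK ?subr_eq0// addrC subrK.
Qed.

(** Caratheodory's form of differentiability writes the increment of F as a continuous factor times
    that of g, which avoids dividing by an increment of g that may vanish. *)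
Lemma diff_quot_comp A g F t (d c : R) :
  (g s - g t) / (s - t) @[s --> within A t^'] --> d ->
  is_derive (g t) 1 F c -> (F (g s) - F (g t)) / (s - t) @[s --> within A t^'] --> c * d.
Proof.
move=> gd /is_derive1_caratheodory[phi [phiE phic <-]].
have h : (phi (g s) * ((g s - g t) / (s - t))) @[s --> within A t^'] --> phi (g t) * d.
  apply: cvgM => //.
  apply: (@cvg_comp _ _ _ g phi _ (nbhs (g t))); last exact: phic.
  exact: diff_quot_cvg gd.
apply: cvg_trans h; apply: near_eq_cvg; apply: nearW => s.
by rewrite /= phiE mulrA.
Qed.

(** This gives access to the usual differentiation rules at the points of ]0, b[. *)
Lemma diff_quot_interior A g t (d : R) : nbhs t A ->
  ((g s - g t) / (s - t) @[s --> within A t^'] --> d) <-> is_derive t 1 g d.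
Proof.
move=> At; split.
  move=> gd; apply/is_derive1_caratheodory.
  exists (fun z => if z == t then d else (g z - g t) / (z - t)); split.
  - move=> z; case: eqP => [->|/eqP]; first by rewrite !subrr mulr0.
    by rewrite -subr_eq0 => /divfK->.
  - apply/continuous_withinNx; rewrite eqxx.
    move=> U /gd hU; apply: (@filterS2 _ (nbhs t) _ _ _ _ _ At hU) => s As h st.
    by rewrite /= (negbTE st); exact: h.
  - by rewrite eqxx.
move=> /is_derive1_caratheodory[phi [phiE phic <-]].
have h : phi s @[s --> within A t^'] --> phi t.
  apply: cvg_within_filter; apply: cvg_trans phic.
  apply: cvg_app; exact: nbhs_dnbhs.
apply: cvg_trans h; apply: near_eq_cvg.
apply: (@filterS _ (nbhs t) _ setT _ _ filterT) => s _ st _ /=.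
by rewrite phiE mulfK ?subr_eq0.
Qed.

(** Properness makes limits unique, hence [derive_in] computable, also at 0 and b. A step of length
    at most b/2 away from the nearer end stays in [0, b]. *)
Lemma within_itv_proper (b t : R) : 0 < b -> 0 <= t <= b ->
  ProperFilter (within `[0, b]%classic t^').
Proof.
move=> b0 /andP[t0 tb]; apply: Build_ProperFilter_ex.
move=> P; rewrite within_dnbhsE => -[d /= d0 hd].
pose e := Num.min (d / 2) (b / 2).
have e0 : 0 < e by rewrite lt_min !divr_gt0.
have ed : e < d by rewrite gt_min; apply/orP; left; lra.
have eb : e <= b / 2 by rewrite ge_min lexx orbT.
have [tb2|tb2] := leP t (b / 2).
  exists (t + e); apply: hd.
  - by rewrite /ball/= opprD addNKr normrN gtr0_norm.
  - by rewrite -subr_eq0 addrAC subrr add0r gt_eqF.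
  - by rewrite /= in_itv/=; apply/andP; split; lra.
exists (t - e); apply: hd.
- by rewrite /ball/= subKr gtr0_norm.
- by rewrite -subr_eq0 addrAC subrr add0r oppr_eq0 gt_eqF.
- by rewrite /= in_itv/=; apply/andP; split; lra.
Qed.

End derive_within.

(** * Primitives and Abel's equation *)

Section abel.
Context {R : realType}.
Notation mu := (@lebesgue_measure R).

Definition int_powR (q : R) (n : R -> R) (x : R) :=
  \int[mu]_(u in `[0, x]) (u `^ q * n u).

Lemma is_derive_int_powR (q : R) (n : R -> R) (x : R) : -1 < q -> 0 < x ->
  bounded_continuous n -> is_derive x 1 (int_powR q n) (x `^ q * n x).
Proof.
move=> q1 x0 nb; have [nc _] := nb.
have x1 : x < x + 1 by rewrite ltrDl.
have ni : mu.-integrable `[0, x + 1] (EFin \o (fun u => u `^ q * n u)).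
  by apply: integrable_powRM => //; rewrite addr_gt0.
have nx : {for x, continuous (fun u => u `^ q * n u)}.
  by apply: cvgM; [exact: continuous_powR|exact: nc].
have [d1 d2] := continuous_FTC1_closed x1 ni x0 nx.
apply: DeriveDef; first exact: d1.
by rewrite -derive1E; exact: d2.
Qed.

(** The primitive is the Riesz integral with p = 0, that is, x^(q + 1) times an average that is
    continuous at 0. *)
Lemma int_powR_cvg0 (q : R) (n : R -> R) : -1 < q <= 0 -> bounded_continuous n ->
  int_powR q n x @[x --> 0^'+] --> 0.
Proof.
move=> qr nb; have /andP[q1 q0] := qr.
have r0 : -1 < (0 : R) <= 0 by rewrite lexx ltrN10.
have h : (x `^ (q + 1) * beta_avg 0 q n x) @[x --> 0^'+] --> 0 * beta_avg 0 q n 0.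
  apply: cvgM; first by apply: powR_cvg0; lra.
  by apply: cvg_at_right_filter; exact: continuous_beta_avg.
rewrite mul0r in h; apply: cvg_trans h; apply: near_eq_cvg; near=> x.
have x0 : 0 < x by [].
rewrite -[q + 1]add0r addrA -(Rintegral_powR_beta_avg 0 q r0 qr n x nb x0).
by apply: eq_Rintegral => u _; rewrite powRr0 mul1r.
Unshelve. all: by end_near. Qed.

Lemma continuous_eq0_itvcc (m : R -> R) (X : R) : 0 < X -> continuous m ->
  (forall x, 0 < x < X -> m x = 0) -> forall x, 0 <= x <= X -> m x = 0.
Proof.
move=> X0 mc m0 x /andP[x0 xX].
move: x0; rewrite le_eqVlt => /predU1P[<-|x0].
  have h : m y @[y --> 0^'+] --> m 0 by apply: cvg_at_right_filter; exact: mc.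
  have h' : m y @[y --> 0^'+] --> (0 : R).
    apply: cvg_trans (@cvg_cst _ (0 : R) _ (0^'+) _); apply: near_eq_cvg; near=> y.
    by rewrite m0//; apply/andP; split; near: y;
      [exact: nbhs_right_gt|exact: nbhs_right_lt].
  exact: (cvg_unique _ h h').
move: xX; rewrite le_eqVlt => /predU1P[->|xX]; last by rewrite m0// x0.
have h : m y @[y --> X^'-] --> m X by apply: cvg_at_left_filter; exact: mc.
have h' : m y @[y --> X^'-] --> (0 : R).
  apply: cvg_trans (@cvg_cst _ (0 : R) _ (X^'-) _); apply: near_eq_cvg; near=> y.
  by rewrite m0//; apply/andP; split; near: y;
    [exact: nbhs_left_gt|exact: nbhs_left_lt].
exact: (cvg_unique _ h h').
Unshelve. all: by end_near. Qed.

Variables (alpha X : R).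
Hypotheses (alpha_range : 2^-1 < alpha < 1) (X_gt0 : 0 < X).

Let Na_range : -1 < - alpha <= 0.
Proof. by case/andP: alpha_range => h1 h2; apply/andP; split; lra. Qed.

Let a1_range : -1 < alpha - 1 <= 0.
Proof. by case/andP: alpha_range => h1 h2; apply/andP; split; lra. Qed.

Notation abel := (beta_avg (- alpha) (alpha - 1)).

(** Abel's inversion: applying the kernel of order alpha to the vanishing average of h - k gives a
    vanishing primitive of u^(alpha - 1) (h - k), which is then differentiated. Continuity recovers
    the end points. *)
Lemma beta_avg_inj (h k : R -> R) :
  bounded_continuous h -> bounded_continuous k ->
  (forall x, 0 < x < X -> abel h x = abel k x) ->
  forall x, 0 <= x <= X -> h x = k x.
Proof.
move=> hb kb hk; pose m x := h x - k x.
have mb : bounded_continuous m by exact: bounded_continuousB.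
have [mc _] := mb.
have am x : 0 <= x <= X -> abel m x = 0.
  apply: continuous_eq0_itvcc => //; first exact: continuous_beta_avg.
  move=> {}x /hk e.
  by rewrite (beta_avgB _ _ Na_range a1_range _ _ _ hb kb) e subrr.
have im x : 0 < x < X -> int_powR (alpha - 1) m x = 0.
  move=> /andP[x0 xX].
  have pp : - alpha + (alpha - 1) = -1 by ring.
  have := beta_avg_semigroup _ _ _ Na_range a1_range a1_range pp m x mb x0.
  rewrite (_ : \int[mu]_(s in `[0, x]) _ = 0); last first.
    rewrite [LHS](_ : _ = \int[mu]_(s in `[0, x]) (cst 0 : R -> R) s).
      by rewrite Rintegral_cst// mul0r.
    apply: eq_Rintegral => s; rewrite inE/= in_itv/= => /andP[s0 sx].
    by rewrite am ?mulr0// s0 (le_trans sx (ltW xX)).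
  move=> /esym/eqP; rewrite mulf_eq0 => /orP[|/eqP//].
  by rewrite gt_eqF// beta_gt0.
move=> x xX; apply/eqP; rewrite -subr_eq0; apply/eqP; move: x xX.
apply: (continuous_eq0_itvcc m) => // x xX; have /andP[x0 xX'] := xX.
have [q1 _] := andP a1_range.
have d1 := is_derive_int_powR _ _ _ q1 x0 mb.
have d2 : is_derive x 1 (int_powR (alpha - 1) m) 0.
  apply: (@near_eq_is_derive _ _ _ (cst 0)).
  have : \forall y \near x, y \in `]0, X[ by apply: near_in_itvoo; rewrite in_itv.
  by apply: filterS => y; rewrite in_itv/= => /im.
have : x `^ (alpha - 1) * m x = 0.
  by rewrite -(@derive_val _ _ _ _ _ _ _ d1) (@derive_val _ _ _ _ _ _ _ d2).
by move=> /eqP; rewrite mulf_eq0 gt_eqF ?powR_gt0// => /eqP.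
Qed.

(** The kernel of order 1 - alpha is applied to the Volterra equation: composed with the kernel of
    order alpha, it leaves a primitive. *)
Lemma beta_avg_volterra (c0 k0 : R) (n k : R -> R) :
  k0 != 0 -> bounded_continuous n -> bounded_continuous k ->
  (forall x, 0 <= x <= X -> k x =
     c0 + k0 * (x `^ alpha * beta_avg (alpha - 1) (alpha - 1) n x)) ->
  forall x, 0 < x <= X -> abel k x =
    beta (- alpha) (alpha - 1) * (c0 + k0 * int_powR (alpha - 1) n x).
Proof.
move=> k00 nb kb kE x /andP[x0 xX].
have [al1 al2] := andP alpha_range.
(* On [0, X] this is u^alpha times the average of n, but the latter may be unbounded on the line,
   whereas m is bounded. *)
pose m u := k0^-1 * (k u - c0).
have mb : bounded_continuous m.
  apply: bounded_continuousM; first exact: bounded_continuous_cst.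
  by apply: bounded_continuousB => //; exact: bounded_continuous_cst.
have km : k = (fun u => cst c0 u + k0 * m u).
  by apply/funext => u; rewrite /m mulVKf//= addrC subrK.
rewrite km beta_avgD//; [|exact: bounded_continuous_cst|]; last first.
  by apply: bounded_continuousM => //; exact: bounded_continuous_cst.
rewrite beta_avg_cst// beta_avgZ//.
have e0 : - alpha + (alpha - 1) + 1 = 0 by ring.
have := Rintegral_powR_beta_avg _ _ Na_range a1_range m x mb x0.
rewrite e0 powRr0 mul1r => <-.
have pp : alpha - 1 + - alpha = -1 by ring.
have := beta_avg_semigroup _ _ _ a1_range Na_range a1_range pp n x nb x0.
rewrite -/(int_powR (alpha - 1) n x) => sg.
rewrite (_ : \int[mu]_(u in `[0, x]) ((x - u) `^ (- alpha) * (u `^ (alpha - 1) * m u)) =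
  beta (- alpha) (alpha - 1) * int_powR (alpha - 1) n x); first by ring.
rewrite -sg; apply: eq_Rintegral => u; rewrite inE/= in_itv/= => /andP[u0 ux].
congr (_ * _).
have mE : m u = u `^ alpha * beta_avg (alpha - 1) (alpha - 1) n u.
  by rewrite /m kE ?u0 ?(le_trans ux xX)// addrAC subrr add0r mulKf.
rewrite mE mulrA; congr (_ * _).
(* At u = 0 both sides are 0; the exponent 2 alpha - 1 on the right is nonzero because alpha >
   1/2. *)
have [->|un0] := eqVneq u 0.
  by rewrite !powR0 ?mul0r//; apply/eqP; lra.
rewrite -powRD ?un0 ?implybT//; congr (_ `^ _); ring.
Qed.

End abel.

(** * The initial value problem *)

Section ivp.
Context {R : realType}.
Variables (b : R) (Psi : R -> R).
Notation mu := (@lebesgue_measure R).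
Hypotheses (b_gt0 : 0 < b)
  (Psi_smooth : smooth_in `[0, b] Psi)
  (Psi_mono : {in `[0, b] &, {homo Psi : s t / s <= t}})
  (dPsi_gt0 : {ae mu, forall t, `[0, b]%classic t -> 0 < dPsi b Psi t}).

Lemma Psi_diff_quot (t : R) : 0 <= t <= b ->
  (Psi s - Psi t) / (s - t) @[s --> within `[0, b]%classic t^'] --> dPsi b Psi t.
Proof. by move=> tb; apply: (Psi_smooth 0%N t); rewrite /= in_itv/=. Qed.

Lemma within_continuous_Psi : {within `[0, b], continuous Psi}.
Proof.
apply/subspace_continuousP => t; rewrite /= in_itv/= => tb.
by apply: cvg_within_dnbhs; apply: diff_quot_cvg; exact: Psi_diff_quot.
Qed.

Lemma within_continuous_dPsi : {within `[0, b], continuous (dPsi b Psi)}.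
Proof.
apply/subspace_continuousP => t; rewrite /= in_itv/= => tb.
apply: cvg_within_dnbhs; apply: diff_quot_cvg.
by apply: (Psi_smooth 1%N t); rewrite /= in_itv/=.
Qed.

Lemma nbhs_itvcc (t : R) : 0 < t < b -> nbhs t `[0, b]%classic.
Proof.
move=> tb; apply: (@filterS _ (nbhs t) _ `]0, b[%classic).
  exact: subset_itv_oo_cc.
by apply: near_in_itvoo; rewrite in_itv.
Qed.

Lemma is_derive_Psi (t : R) : 0 < t < b -> is_derive t 1 Psi (dPsi b Psi t).
Proof.
move=> tb; apply/(diff_quot_interior _ _ _ _ (nbhs_itvcc _ tb)).
by apply: Psi_diff_quot; case/andP: tb => /ltW-> /ltW->.
Qed.

Lemma continuous_Psi : {in `]0, b[, continuous Psi}.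
Proof.
by have /(continuous_within_itvP _ b_gt0)[] := within_continuous_Psi.
Qed.

Lemma continuous_dPsi : {in `]0, b[, continuous (dPsi b Psi)}.
Proof.
by have /(continuous_within_itvP _ b_gt0)[] := within_continuous_dPsi.
Qed.

(** Equal values at s < t would make Psi constant in between, and its derivative 0 on an interval of
    positive measure. *)
Lemma Psi_increasing : {in `[0, b] &, {homo Psi : s t / s < t}}.
Proof.
move=> s t sb tb st; rewrite lt_neqAle Psi_mono ?(ltW st)// andbT.
apply/eqP => est.
have [s0 sb'] : 0 <= s /\ s <= b by apply/andP; move: sb; rewrite in_itv.
have [t0 tb'] : 0 <= t /\ t <= b by apply/andP; move: tb; rewrite in_itv.
have cst u : s <= u -> u <= t -> Psi u = Psi s.
  move=> su ut; have ub : u \in `[0, b] by rewrite in_itv/= (le_trans s0 su) (le_trans ut tb').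
  by apply/eqP; rewrite eq_le {1}est !Psi_mono.
have d0 u : s < u < t -> dPsi b Psi u = 0.
  move=> /andP[su ut].
  have ub : 0 < u < b by rewrite (le_lt_trans s0 su) (lt_le_trans ut tb').
  have h1 := is_derive_Psi _ ub.
  have h2 : is_derive u 1 Psi 0.
    apply/(diff_quot_interior _ _ _ _ (nbhs_itvcc _ ub)).
    apply: cvg_trans (@cvg_cst _ (0 : R) _ (within `[0, b]%classic u^') _).
    apply: near_eq_cvg.
    have : nbhs u `]s, t[%classic by apply: near_in_itvoo; rewrite in_itv/= su ut.
    apply: filterS => v; rewrite /= in_itv/= => /andP[sv vt] _ _.
    by rewrite !cst ?subrr ?mul0r// ltW.
  by rewrite -(@derive_val _ _ _ _ _ _ _ h1) (@derive_val _ _ _ _ _ _ _ h2).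
have [A [mA A0 sA]] := dPsi_gt0.
have : (mu `]s, t[%classic <= mu A)%E.
  apply: le_measure; rewrite ?inE//; apply: subset_trans sA => u /=.
  rewrite in_itv/= => stu /(_ _); have /andP[su ut] := stu.
  rewrite in_itv/= (le_trans s0 (ltW su)) (le_trans (ltW ut) tb') => /(_ isT).
  by rewrite d0// ltxx.
by rewrite A0 lebesgue_measure_itv/= lte_fin st -EFinD lee_fin subr_le0 leNgt st.
Qed.

Definition shifted_Psi (t : R) := Psi t - Psi 0.
Notation P := shifted_Psi.

Lemma shifted_Psi0 : P 0 = 0. Proof. exact: subrr. Qed.

Lemma shifted_Psi_lt (s t : R) : 0 <= s -> s < t -> t <= b -> P s < P t.
Proof.
move=> s0 st tb; rewrite ltrD2r Psi_increasing// in_itv/=.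
  by rewrite s0 (le_trans (ltW st)).
by rewrite (le_trans s0 (ltW st)).
Qed.

Lemma shifted_Psi_le (s t : R) : 0 <= s -> s <= t -> t <= b -> P s <= P t.
Proof.
by move=> s0; rewrite le_eqVlt => /predU1P[->//|st] tb; rewrite ltW// shifted_Psi_lt.
Qed.

Lemma shifted_Psi_gt0 (t : R) : 0 < t <= b -> 0 < P t.
Proof. by move=> /andP[t0 tb]; rewrite -shifted_Psi0 shifted_Psi_lt. Qed.

Lemma within_continuous_shifted_Psi : {within `[0, b], continuous P}.
Proof.
move=> t; apply: cvgB; [exact: within_continuous_Psi|exact: cvg_cst].
Qed.

(** As Psi' may vanish, Q is only known to be continuous. Integrals are therefore substituted along
    P, and Q merely serves to read functions of t as functions of x. *)
Lemma shifted_Psi_inverse : exists Q : R -> R,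
  [/\ {within `[0, P b], continuous Q},
      forall t, 0 <= t <= b -> Q (P t) = t,
      forall x, 0 <= x <= P b -> P (Q x) = x &
      forall x, 0 < x <= P b -> 0 < Q x <= b].
Proof.
have Pc := within_continuous_shifted_Psi.
have b0 := ltW b_gt0.
have Pb0 : 0 < P b by apply: shifted_Psi_gt0; rewrite b_gt0 lexx.
have surj x : 0 <= x <= P b -> exists2 t, 0 <= t <= b & P t = x.
  move=> xb; have := @segment_continuous_le_surjective R 0 b P b0 _ Pc.
  rewrite shifted_Psi0 => /(_ (ltW Pb0) x) []; first by rewrite /= in_itv.
  by move=> t; rewrite /= in_itv/= => tb <-; exists t.
have inj s t : 0 <= s <= b -> 0 <= t <= b -> P s = P t -> s = t.
  move=> /andP[s0 sb] /andP[t0 tb] e; have [st|ts|//] := ltgtP s t.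
    by have := shifted_Psi_lt _ _ s0 st tb; rewrite e ltxx.
  by have := shifted_Psi_lt _ _ t0 ts sb; rewrite e ltxx.
have /choice[Q hQ] : forall x, exists t, 0 <= x <= P b -> 0 <= t <= b /\ P t = x.
  move=> x; have [/surj[t tb Pt]|nx] := pselect (0 <= x <= P b).
    by exists t.
  by exists 0.
have QP t : 0 <= t <= b -> Q (P t) = t.
  move=> tb; have /andP[t0 tb'] := tb.
  have Ptb : 0 <= P t <= P b.
    by rewrite -shifted_Psi0 !shifted_Psi_le.
  by have [h1 h2] := hQ _ Ptb; exact: inj.
exists Q; split => //.
- have := @segment_can_le_continuous R 0 b P Q b0 Pc.
  by rewrite shifted_Psi0; apply => t; rewrite in_itv/= => /QP.
- by move=> x /hQ[].
- move=> x /andP[x0 xb].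
  have [/andP[h0 h1] h2] := hQ x (introT andP (conj (ltW x0) xb)).
  rewrite h1 andbT lt_neqAle h0 andbT; apply/eqP => e.
  by move: x0; rewrite -h2 -e shifted_Psi0 ltxx.
Qed.

(** The exponentials merge into exp(-lambda Psi t), which leaves the integral, and u = P s turns the
    rest into a Riesz integral. Its power of P t is 0, as the exponents -alpha and alpha - 1 add up
    to -1. *)
Lemma tempered_int_beta_avg (alpha lambda : R) (y h : R -> R) (t : R) :
  0 < alpha < 1 -> bounded_continuous h ->
  (forall s, 0 < s <= b ->
    y s = expR (- (lambda * Psi s)) * (P s `^ (alpha - 1) * h (P s))) ->
  0 < t <= b ->
  tempered_int b Psi (1 - alpha) lambda y t =
  (Gamma (1 - alpha))^-1 *
    (expR (- (lambda * Psi t)) * beta_avg (- alpha) (alpha - 1) h (P t)).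
Proof.
move=> /andP[a0 a1] hb yE tb; have /andP[t0 tb'] := tb.
have r1 : -1 < - alpha <= 0 by apply/andP; split; lra.
have r2 : -1 < alpha - 1 <= 0 by apply/andP; split; lra.
rewrite /tempered_int; congr (_ * _).
pose c := expR (- (lambda * Psi t)).
pose k u := c * h u.
have kb : bounded_continuous k.
  by apply: bounded_continuousM hb; exact: bounded_continuous_cst.
pose G u := (P t - u) `^ (- alpha) * (u `^ (alpha - 1) * k u).
have Pt0 := shifted_Psi_gt0 _ tb.
have [hc _] := hb; have [kc _] := kb.
have Gc u : 0 < u < P t -> {for u, continuous G}.
  move=> /andP[u0 uP]; apply: cvgM.
    apply: (@continuous_comp _ _ _ (fun u : R => P t - u) (@powR R ^~ (- alpha))).
      by apply: cvgB; [exact: cvg_cst|exact: cvg_id].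
    by apply: continuous_powR; rewrite subr_gt0.
  by apply: cvgM; [exact: continuous_powR|exact: kc].
have sub s : 0 < s < t -> 0 < s < b.
  by move=> /andP[-> st]; rewrite (lt_le_trans st).
have E : \int[mu]_(s in `[0, t]) (G (P s) * dPsi b Psi s) =
    \int[mu]_(u in `[P 0, P t]) G u.
  apply: (@integration_by_substitution_cc R P (dPsi b Psi) G 0 t t0).
  - move=> u v; rewrite !in_itv/= => /andP[u0 _] /andP[_ vt] uv.
    by rewrite shifted_Psi_lt// (le_trans vt).
  - apply: continuous_subspaceW within_continuous_shifted_Psi.
    by apply: subset_itvl; rewrite bnd_simp.
  - move=> s /sub sb; have := is_derive_Psi _ sb => Ps.
    have := is_deriveB Ps (is_derive_cst (Psi 0) s (1 : R)).
    by rewrite subr0.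
  - by move=> s; rewrite in_itv/= => /sub sb; apply: continuous_dPsi; rewrite in_itv.
  - by move=> u; rewrite shifted_Psi0; exact: Gc.
rewrite shifted_Psi0 in E.
transitivity (\int[mu]_(s in `[0, t]) (G (P s) * dPsi b Psi s)).
  have mG : measurable_fun `]0, t[ (fun s => G (P s) * dPsi b Psi s).
    apply: open_continuous_measurable_fun => // s.
    rewrite inE/= in_itv/= => st; have sb := sub _ st.
    apply: cvgM; last by apply: continuous_dPsi; rewrite in_itv.
    apply: (@continuous_comp _ _ _ P G).
      by apply: cvgB; [apply: continuous_Psi; rewrite in_itv|exact: cvg_cst].
    apply: Gc; have /andP[s0 st'] := st.
    by rewrite -{1}shifted_Psi0 !shifted_Psi_lt// ?(ltW s0) ?(ltW (lt_le_trans st' tb')).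
  have eqG s : 0 < s < t -> dPsi b Psi s * (Psi t - Psi s) `^ (1 - alpha - 1) *
      expR (- (lambda * (Psi t - Psi s))) * y s = G (P s) * dPsi b Psi s.
    move=> st; have /andP[s0 sb] := sub _ st.
    rewrite yE ?s0 ?(ltW sb)// /G /k /c.
    have -> : P t - P s = Psi t - Psi s by rewrite /P; ring.
    have -> : 1 - alpha - 1 = - alpha by ring.
    have -> : - (lambda * Psi t) = - (lambda * (Psi t - Psi s)) + - (lambda * Psi s) by ring.
    rewrite expRD; ring.
  (* The integrands are compared on the open interval only, since the value of y at 0 is
     arbitrary. *)
  rewrite /Rintegral; congr fine.
  rewrite integral_itv_bndoo; last first.
    apply/measurable_EFinP.
    apply: (eq_measurable_fun (fun s => G (P s) * dPsi b Psi s)) => //.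
    by move=> s; rewrite inE/= in_itv/= => /eqG ->.
  rewrite [RHS]integral_itv_bndoo; last by apply/measurable_EFinP; exact: mG.
  by apply: eq_integral => s; rewrite inE/= in_itv/= => /eqG ->.
rewrite E Rintegral_powR_beta_avg//.
have -> : - alpha + (alpha - 1) + 1 = 0 by ring.
by rewrite powRr0 mul1r /k beta_avgZ.
Qed.

Variables (alpha lambda : R).
Hypothesis alpha_range : 2^-1 < alpha < 1.

Let X := P b.

Let X_gt0 : 0 < X.
Proof. by apply: shifted_Psi_gt0; rewrite b_gt0 lexx. Qed.

Let Na_range : -1 < - alpha <= 0.
Proof. by case/andP: alpha_range => h1 h2; apply/andP; split; lra. Qed.

Let a1_range : -1 < alpha - 1 <= 0.
Proof. by case/andP: alpha_range => h1 h2; apply/andP; split; lra. Qed.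

Let alpha01 : 0 < alpha < 1.
Proof. by case/andP: alpha_range => h1 h2; apply/andP; split; lra. Qed.

(* The substitution x = Psi t - Psi 0, y = untransform h turns the space
   weighted_C (1 - alpha) into a space of continuous functions of x, and
   removes both Psi and the tempering from the integral operators. *)
Definition untransform (h : R -> R) (t : R) :=
  expR (- (lambda * Psi t)) * (P t `^ (alpha - 1) * h (P t)).

Let P_gt0 t : 0 < t <= b -> 0 < P t.
Proof. exact: shifted_Psi_gt0. Qed.

Let P_itv t : 0 < t <= b -> 0 < P t <= X.
Proof.
move=> tb; rewrite P_gt0//=; have /andP[t0 tb'] := tb.
by apply: shifted_Psi_le => //; exact: ltW.
Qed.

Let powRK (x : R) : 0 < x -> x `^ (1 - alpha) * x `^ (alpha - 1) = 1.
Proof.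
move=> x0; rewrite -powRD ?(gt_eqF x0) ?implybT//.
by rewrite (_ : 1 - alpha + (alpha - 1) = 0) ?powRr0//; ring.
Qed.

Lemma untransformK (h : R -> R) (t : R) : 0 < t <= b ->
  expR (lambda * Psi t) * (P t `^ (1 - alpha) * untransform h t) = h (P t).
Proof.
move=> tb; rewrite /untransform.
have e1 : expR (lambda * Psi t) * expR (- (lambda * Psi t)) = 1.
  by rewrite -expRD subrr expR0.
have e2 := powRK _ (P_gt0 _ tb).
transitivity ((expR (lambda * Psi t) * expR (- (lambda * Psi t))) *
  ((P t `^ (1 - alpha) * P t `^ (alpha - 1)) * h (P t))); first by ring.
by rewrite e1 e2 !mul1r.
Qed.

Lemma untransform_weighted_C (h : R -> R) : continuous h ->
  weighted_C b Psi (1 - alpha) (untransform h).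
Proof.
move=> hc; exists (fun t => expR (- (lambda * Psi t)) * h (P t)); split.
  apply/subspace_continuousP => t tb.
  have /subspace_continuousP/(_ t tb) Pc := within_continuous_shifted_Psi.
  have /subspace_continuousP/(_ t tb) Psic := within_continuous_Psi.
  apply: cvgM.
    apply: (@cvg_comp _ _ _ (fun s => - (lambda * Psi s)) (@expR R) _
      (nbhs (- (lambda * Psi t)))).
      by apply: cvgN; apply: cvgM; [exact: cvg_cst|exact: Psic].
    exact: continuous_expR.
  by apply: (@cvg_comp _ _ _ P h _ (nbhs (P t))); [exact: Pc|exact: hc].
move=> t tb; have e2 := powRK _ (P_gt0 _ tb).
rewrite -/(P t) /untransform.
transitivity ((P t `^ (1 - alpha) * P t `^ (alpha - 1)) *
  (expR (- (lambda * Psi t)) * h (P t))); last by ring.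
by rewrite e2 mul1r.
Qed.

(** The way back from the weighted space: g is the continuous extension of P^(1 - alpha) y, and h
    corresponds to y under [untransform]. *)
Lemma transform (g : R -> R) : {within `[0, b], continuous g} ->
  exists2 h, bounded_continuous h &
    forall t, 0 < t <= b -> h (P t) = expR (lambda * Psi t) * g t.
Proof.
move=> gc.
have [Q [Qc QP PQ Q0]] := shifted_Psi_inverse.
pose k x := expR (lambda * (Psi 0 + x)) * g (Q x).
exists (k \o clamp X).
  apply: bounded_continuous_clamp; first exact: ltW.
  move=> x; apply: cvgM.
    apply: continuous_subspaceT => {}x.
    apply: (@continuous_comp _ _ _ (fun x => lambda * (Psi 0 + x)) (@expR R)).
      apply: cvgM; first exact: cvg_cst.
      by apply: cvgD; [exact: cvg_cst|exact: cvg_id].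
    exact: continuous_expR.
  move: x; apply/subspace_continuousP => x; rewrite /= in_itv/= => xX.
  have Qb y : 0 <= y <= X -> 0 <= Q y <= b.
    move=> /andP[y0 yX]; move: y0; rewrite le_eqVlt => /predU1P[<-|y0].
      have Q00 : Q 0 = 0 by rewrite -{1}shifted_Psi0 QP// lexx ltW.
      by rewrite Q00 lexx ltW.
    by have /andP[/ltW -> ->] := Q0 y (introT andP (conj y0 yX)).
  apply: (@cvg_comp _ _ _ Q g _ (within `[0, b]%classic (nbhs (Q x)))); last first.
    by have /subspace_continuousP := gc; apply; rewrite /= in_itv/=; exact: Qb.
  have /subspace_continuousP/(_ x) := Qc.
  rewrite /= in_itv/= => /(_ xX) Qx U hU.
  apply: (@filterS _ (nbhs x) _ _ _ _ (Qx _ hU)) => y /= h yX.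
  by apply: h => //; rewrite in_itv/=; apply: Qb; move: yX; rewrite in_itv.
move=> t tb; have /andP[P0 PX] := P_itv _ tb.
rewrite /= clamp_id ?PX ?ltW// /k QP; last by case/andP: tb => /ltW -> ->.
by rewrite /shifted_Psi addrC subrK.
Qed.

Lemma tempered_int_untransform (h : R -> R) (y : R -> R) (t : R) :
  bounded_continuous h -> (forall s, 0 < s <= b -> y s = untransform h s) ->
  0 < t <= b -> tempered_int b Psi (1 - alpha) lambda y t =
  (Gamma (1 - alpha))^-1 *
    (expR (- (lambda * Psi t)) * beta_avg (- alpha) (alpha - 1) h (P t)).
Proof. exact: tempered_int_beta_avg. Qed.

Let P_cvg0 : P t @[t --> 0^'+] --> (0 : R).
Proof.
have /(continuous_within_itvP _ b_gt0)[_ + _] :=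
  within_continuous_shifted_Psi.
by rewrite shifted_Psi0.
Qed.

Let Psi_cvg0 : Psi t @[t --> 0^'+] --> Psi 0.
Proof.
by have /(continuous_within_itvP _ b_gt0)[_ + _] := within_continuous_Psi.
Qed.

Let beta_avg_P_cvg0 (h : R -> R) : bounded_continuous h ->
  beta_avg (- alpha) (alpha - 1) h (P t) @[t --> 0^'+] -->
  h 0 * beta (- alpha) (alpha - 1).
Proof.
move=> hb; rewrite -beta_avg0//.
apply: (@cvg_comp _ _ _ P (beta_avg (- alpha) (alpha - 1) h) _ (nbhs (0 : R))).
  exact: P_cvg0.
exact: continuous_beta_avg.
Qed.

(** The exponential in the initial condition multiplies h by exp(lambda Psi), while the tempered
    integral brings out exp(-lambda Psi t); in the limit at 0 the two cancel, so the condition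
    prescribes h 0. The clamp makes the exponential bounded on the line. *)
Lemma initial_value (h y : R -> R) : bounded_continuous h ->
  (forall s, 0 < s <= b -> y s = untransform h s) ->
  tempered_int b Psi (1 - alpha) lambda
    (fun s => expR (lambda * Psi s) * y s) t @[t --> 0^'+] -->
  (Gamma (1 - alpha))^-1 * (h 0 * beta (- alpha) (alpha - 1)).
Proof.
move=> hb yE.
pose e x := expR (lambda * (Psi 0 + x)).
have eb : bounded_continuous (e \o clamp X).
  apply: bounded_continuous_clamp; first exact: ltW.
  apply: continuous_subspaceT => x.
  apply: (@continuous_comp _ _ _ (fun x => lambda * (Psi 0 + x)) (@expR R)).
    apply: cvgM; first exact: cvg_cst.
    by apply: cvgD; [exact: cvg_cst|exact: cvg_id].
  exact: continuous_expR.
pose k x := (e \o clamp X) x * h x.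
have kb : bounded_continuous k by exact: bounded_continuousM.
have yk s : 0 < s <= b -> expR (lambda * Psi s) * y s = untransform k s.
  move=> sb; have /andP[P0 PX] := P_itv _ sb.
  rewrite yE// /untransform /k /= clamp_id ?PX ?ltW// /e.
  rewrite (_ : Psi 0 + P s = Psi s); last by rewrite /shifted_Psi addrC subrK.
  ring.
have k0 : k 0 = expR (lambda * Psi 0) * h 0.
  by rewrite /k/= clamp_id ?lexx ?ltW// /e addr0.
have h1 : (Gamma (1 - alpha))^-1 *
    (expR (- (lambda * Psi t)) * beta_avg (- alpha) (alpha - 1) k (P t)) @[t --> 0^'+] -->
    (Gamma (1 - alpha))^-1 *
    (expR (- (lambda * Psi 0)) * (k 0 * beta (- alpha) (alpha - 1))).
  apply: cvgM; first exact: cvg_cst.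
  apply: cvgM; last exact: beta_avg_P_cvg0.
  apply: (@cvg_comp _ _ _ (fun t => - (lambda * Psi t)) (@expR R) _
    (nbhs (- (lambda * Psi 0)))).
    by apply: cvgN; apply: cvgM; [exact: cvg_cst|exact: Psi_cvg0].
  exact: continuous_expR.
have e1 : expR (- (lambda * Psi 0)) * (k 0 * beta (- alpha) (alpha - 1)) =
    h 0 * beta (- alpha) (alpha - 1).
  by rewrite k0 !mulrA -expRD addNr expR0 mul1r.
rewrite e1 in h1; apply: cvg_trans h1; apply: near_eq_cvg; near=> t.
rewrite (@tempered_int_untransform k)//.
by apply/andP; split; near: t; [exact: nbhs_right_gt|exact: nbhs_right_le].
Unshelve. all: by end_near. Qed.

(** * The superposition operator and the equivalence with the Volterra equation *)

Variables (y0 L : R) (f : R -> R -> R).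
Hypotheses (f_weighted : forall y : R -> R, weighted_C b Psi (1 - alpha) y ->
       weighted_C b Psi (1 - alpha) (fun t => f t (y t)))
  (L_ge0 : 0 <= L)
  (f_lipschitz : forall t u v : R, 0 < t <= b ->
       `|f t u - f t v| <= L * `|u - v|).

(** [f_weighted] only asserts that a continuous extension exists for each y, so the operator is
    obtained by choice; outside the bounded continuous functions its value is arbitrary. *)
Lemma nemytskii_ex : exists N : (R -> R) -> R -> R,
  forall h, bounded_continuous h -> bounded_continuous (N h) /\
    forall t, 0 < t <= b ->
      N h (P t) = expR (lambda * Psi t) * (P t `^ (1 - alpha) * f t (untransform h t)).
Proof.
suff : forall h, exists n, bounded_continuous h -> bounded_continuous n /\
    forall t, 0 < t <= b ->
      n (P t) = expR (lambda * Psi t) * (P t `^ (1 - alpha) * f t (untransform h t)).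
  by move=> /choice[N hN]; exists N.
move=> h; have [hb|nh] := pselect (bounded_continuous h); last by exists h.
have [g [gc gE]] := f_weighted _ (untransform_weighted_C h (proj1 hb)).
have [n nb nE] := transform g gc.
by exists n => _; split => // t tb; rewrite nE// gE.
Qed.

Section with_nemytskii.
Variable N : (R -> R) -> R -> R.
Hypothesis N_bounded_continuous :
  forall h, bounded_continuous h -> bounded_continuous (N h).
Hypothesis NE : forall h, bounded_continuous h -> forall t, 0 < t <= b ->
  N h (P t) = expR (lambda * Psi t) * (P t `^ (1 - alpha) * f t (untransform h t)).

(** Both sides carry the same weight exp(lambda Psi t) P(t)^(1 - alpha), so the constant L is
    unchanged. *)
Lemma nemytskii_lipschitz (h k : R -> R) :
  bounded_continuous h -> bounded_continuous k ->
  forall x, 0 < x <= X -> `|N h x - N k x| <= L * `|h x - k x|.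
Proof.
move=> hb kb x xX.
have [Q [Qc QP PQ Q0]] := shifted_Psi_inverse.
have tb := Q0 x xX; have /andP[x0 xX'] := xX.
have <- : P (Q x) = x by apply: PQ; rewrite xX' ltW.
move: (Q x) tb => t tb.
rewrite !NE// -[in leRHS](untransformK h)// -[in leRHS](untransformK k)//.
move: (untransform h t) (untransform k t) => u v.
rewrite -!mulrBr !normrM (ger0_norm (expR_ge0 _)) (ger0_norm (powR_ge0 _ _)).
rewrite [leRHS]mulrCA ler_wpM2l ?expR_ge0//.
rewrite [leRHS]mulrCA ler_wpM2l ?powR_ge0//.
exact: f_lipschitz.
Qed.

(** Chosen so that the average of order 1 - alpha of the Volterra equation becomes Gamma(1 - alpha)
    (y0 + primitive), whose factor cancels the one in [tempered_int]. *)
Let c0 := Gamma (1 - alpha) * y0 / beta (- alpha) (alpha - 1).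
Let k0 := Gamma (1 - alpha) / beta (- alpha) (alpha - 1).

Let Gamma_pos : 0 < Gamma (1 - alpha).
Proof. by apply: Gamma_gt0; case/andP: alpha_range => h1 h2; apply/andP; split; lra. Qed.

Let beta_pos : 0 < beta (- alpha) (alpha - 1).
Proof. exact: beta_gt0. Qed.

Let k0_neq0 : k0 != 0.
Proof. by rewrite mulf_neq0 ?invr_eq0 ?gt_eqF. Qed.

Notation volt := (volterra alpha c0 k0 N).
Notation W n := (int_powR (alpha - 1) n).

(** h and k are kept apart in order to take for k the clamped right-hand side, before h is known to
    satisfy the equation. *)
Lemma abel_volterra (h k : R -> R) : bounded_continuous h -> bounded_continuous k ->
  (forall x, 0 <= x <= X -> k x = volt h x) ->
  forall x, 0 < x <= X -> beta_avg (- alpha) (alpha - 1) k x =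
    Gamma (1 - alpha) * (y0 + W (N h) x).
Proof.
move=> hb kb kE x xX.
rewrite (beta_avg_volterra alpha X alpha_range c0 k0 (N h) k)//; last first.
  exact: N_bounded_continuous.
by rewrite /c0 /k0; field; rewrite gt_eqF.
Qed.

Lemma volterra_sub_solution (h : R -> R) : bounded_continuous h ->
  (forall x, 0 <= x <= X -> h x = volt h x) ->
  tempered_IVP_solution b Psi alpha lambda y0 f (untransform h).
Proof.
move=> hb hV; have [hc _] := hb.
have nb := N_bounded_continuous _ hb.
(* The tempered integral is a function H of Psi t. H has a two-sided derivative even at Psi b, as
   [N h] is defined beyond X, so the chain rule also covers t = b. *)
pose H v := expR (- (lambda * v)) * (y0 + W (N h) (v - Psi 0)).
have tE t : 0 < t <= b ->
    tempered_int b Psi (1 - alpha) lambda (untransform h) t = H (Psi t).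
  move=> tb; rewrite (@tempered_int_untransform h)//.
  rewrite (abel_volterra h h)//; last exact: P_itv.
  by rewrite /H mulrCA [(Gamma _)^-1 * _]mulrA mulVf ?gt_eqF// mul1r.
have quot t : 0 < t <= b -> let c := expR (- (lambda * Psi t)) *
    (P t `^ (alpha - 1) * N h (P t) - lambda * (y0 + W (N h) (P t))) in
    (tempered_int b Psi (1 - alpha) lambda (untransform h) s -
     tempered_int b Psi (1 - alpha) lambda (untransform h) t) / (s - t)
     @[s --> within `[0, b]%classic t^'] --> c * dPsi b Psi t.
  move=> tb c; have /andP[t0 tb'] := tb.
  have dH : is_derive (Psi t) 1 H c.
    have [q1 _] := andP a1_range.
    have d1 := is_derive_int_powR _ _ _ q1 (P_gt0 _ tb) nb.
    have d2 := is_deriveB (is_derive_id (Psi t) (1 : R))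
      (is_derive_cst (Psi 0) (Psi t) (1 : R)).
    have d3 := @is_derive1_comp R (W (N h)) (fun v => v - Psi 0) (Psi t) _ _ d1 d2.
    have d4 := is_deriveD (is_derive_cst y0 (Psi t) (1 : R)) d3.
    have d5 := is_deriveN (is_deriveZ lambda (is_derive_id (Psi t) (1 : R))).
    have d6 := @is_derive1_comp R (@expR R) (fun v => - (lambda * v)) (Psi t) _ _
      (is_derive_expR _) d5.
    have d7 : is_derive (Psi t) 1 H _ := is_deriveM d6 d4.
    apply: (is_derive_eq d7).
    transitivity (expR (- (lambda * Psi t)) *
        (0 + P t `^ (alpha - 1) * N h (P t) * (1 - 0)) +
      (y0 + W (N h) (P t)) * (expR (- (lambda * Psi t)) * - (lambda * 1))).
      exact: erefl.
    by rewrite /c; ring.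
  have tb2 : 0 <= t <= b by rewrite tb' ltW.
  have := diff_quot_comp _ _ _ _ _ _ (Psi_diff_quot _ tb2) dH.
  apply: cvg_trans; apply: near_eq_cvg.
  have : \forall s \near t, 0 < s by exact: lt_nbhsr.
  apply: filterS => s s0 _ /=; rewrite in_itv/= => /andP[_ sb].
  by rewrite !tE// s0.
split.
- exact: untransform_weighted_C.
- by move=> t tb; apply/cvg_ex; eexists; exact: (quot _ tb).
- move=> t tb d0; rewrite /tempered_RL_derive.
  have tb2 : 0 <= t <= b by case/andP: tb => /ltW -> ->.
  have PF := within_itv_proper _ _ b_gt0 tb2.
  have -> : derive_in `[0, b] (tempered_int b Psi (1 - alpha) lambda (untransform h)) t =
    expR (- (lambda * Psi t)) *
    (P t `^ (alpha - 1) * N h (P t) - lambda * (y0 + W (N h) (P t))) * dPsi b Psi t.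
    by apply/cvg_lim => //; exact: quot.
  rewrite tE// /H NE//.
  have e1 : expR (lambda * Psi t) * expR (- (lambda * Psi t)) = 1.
    by rewrite -expRD subrr expR0.
  have e2 := powRK _ (P_gt0 _ tb).
  rewrite mulrCA mulVf// mulr1 -/(P t).
  transitivity ((expR (lambda * Psi t) * expR (- (lambda * Psi t))) *
    ((P t `^ (1 - alpha) * P t `^ (alpha - 1)) * f t (untransform h t))).
    by ring.
  by rewrite e1 e2 !mul1r.
- have -> : y0 = (Gamma (1 - alpha))^-1 * (h 0 * beta (- alpha) (alpha - 1)).
    rewrite hV ?lexx ?ltW// /volterra powR0; last by case/andP: alpha01 => /gt_eqF ->.
    by rewrite mul0r mulr0 addr0 /c0; field; rewrite !gt_eqF.
  exact: initial_value.
Qed.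

Lemma solution_sub_volterra (z : R -> R) :
  tempered_IVP_solution b Psi alpha lambda y0 f z ->
  exists h, [/\ bounded_continuous h,
    forall t, 0 < t <= b -> z t = untransform h t &
    forall x, 0 <= x <= X -> h x = volt h x].
Proof.
move=> [[g [gc gE]] zd zeq z0].
have [h hb hE] := transform g gc.
have zE t : 0 < t <= b -> z t = untransform h t.
  move=> tb; rewrite /untransform hE// gE// -/(P t).
  have e1 : expR (lambda * Psi t) * expR (- (lambda * Psi t)) = 1.
    by rewrite -expRD subrr expR0.
  have e2 := powRK _ (P_gt0 _ tb).
  transitivity ((expR (lambda * Psi t) * expR (- (lambda * Psi t))) *
    ((P t `^ (1 - alpha) * P t `^ (alpha - 1)) * z t)); last by ring.
  by rewrite e1 e2 !mul1r.
have nb := N_bounded_continuous _ hb.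
have /andP[q1 _] := a1_range.
exists h; split => //.
pose tz := tempered_int b Psi (1 - alpha) lambda z.
have tzE t : 0 < t <= b -> tz t = (Gamma (1 - alpha))^-1 *
    (expR (- (lambda * Psi t)) * beta_avg (- alpha) (alpha - 1) h (P t)).
  by move=> tb; rewrite /tz (@tempered_int_untransform h).
(* A first integral of the equation: w is differentiable at every interior point, its derivative
   vanishes wherever Psi' does not, and its limit at 0 is y0. *)
pose w t := expR (lambda * Psi t) * tz t - W (N h) (P t).
have wE t : 0 < t <= b ->
    w t = (Gamma (1 - alpha))^-1 * beta_avg (- alpha) (alpha - 1) h (P t) - W (N h) (P t).
  move=> tb; rewrite /w tzE// mulrCA [expR _ * (_ * _)]mulrA -expRD subrr expR0.
  by rewrite mul1r.
have dw t : 0 < t < b -> is_derive t 1 w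
    (expR (lambda * Psi t) * (derive_in `[0, b] tz t + lambda * dPsi b Psi t * tz t) -
     P t `^ (alpha - 1) * N h (P t) * dPsi b Psi t).
  move=> tb; have tb' : 0 < t <= b by case/andP: tb => -> /ltW.
  have d1 : is_derive t 1 tz (derive_in `[0, b] tz t).
    by apply/(diff_quot_interior _ _ _ _ (nbhs_itvcc _ tb)); exact: zd.
  have d2 := is_derive_Psi _ tb.
  have d3 := @is_derive1_comp R (@expR R) (fun s => lambda * Psi s) t _ _
    (is_derive_expR _) (is_deriveZ lambda d2).
  have d4 := is_deriveB d2 (is_derive_cst (Psi 0) t (1 : R)).
  have d5 := @is_derive1_comp R (W (N h)) P t _ _
    (is_derive_int_powR _ _ _ q1 (P_gt0 _ tb') nb) d4.
  have d6 : is_derive t 1 w _ := is_deriveB (is_deriveM d3 d1) d5.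
  apply: (is_derive_eq d6).
  by rewrite /GRing.scale/=; ring.
have dw0 t : 0 < t < b -> dPsi b Psi t != 0 -> derive1 w t = 0.
  move=> tb d0; have dwt := dw _ tb; rewrite derive1E derive_val.
  have tb' : 0 < t <= b by case/andP: tb => -> /ltW.
  have := zeq _ tb' d0; rewrite /tempered_RL_derive -/tz zE// => e.
  rewrite NE// -e.
  have e2 := powRK _ (P_gt0 _ tb').
  set D := derive_in _ _ _; set d := dPsi b Psi t in d0 *.
  transitivity (expR (lambda * Psi t) * (D + lambda * d * tz t) -
    (P t `^ (1 - alpha) * P t `^ (alpha - 1)) *
    (expR (lambda * Psi t) * (d^-1 * d * D + lambda * d * tz t))); first by ring.
  by rewrite e2 mulVf// !mul1r subrr.
have wcst s t : 0 < s -> s <= t -> t < b -> w s = w t.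
  move=> s0 st tb; apply: (eq_ae_derive1_0 _ _ _ st).
    by move=> u /andP[su ut]; have [] := dw u; rewrite ?(lt_le_trans s0 su) ?(le_lt_trans ut tb).
  apply: (@filterS _ _ (ae_filter_ringOfSetsType mu) _ _ _ dPsi_gt0) => u h1 /andP[su ut].
  have u0 := lt_le_trans s0 su; have ub := le_lt_trans ut tb.
  apply: dw0; first by rewrite u0.
  by rewrite gt_eqF// h1//= in_itv/= !ltW.
have wlim : w t @[t --> 0^'+] --> y0.
  have -> : y0 = (Gamma (1 - alpha))^-1 * (h 0 * beta (- alpha) (alpha - 1)) - 0.
    by rewrite subr0; exact: (cvg_unique _ z0 (initial_value h z hb zE)).
  (* Convergence from the right is needed, as the primitive is only known to have a right limit at
     0. *)
  have hP : P t @[t --> 0^'+] --> 0^'+.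
    have tb : \forall t \near (0 : R)^'+, 0 < t <= b.
      by near=> t; apply/andP; split; near: t; [exact: nbhs_right_gt|exact: nbhs_right_le].
    move=> U hU; apply: (@filterS2 _ ((0 : R)^'+) _ _ _ _ _ tb (P_cvg0 _ hU)).
    by move=> t /P_gt0 Pt; exact.
  have h1 : ((Gamma (1 - alpha))^-1 * beta_avg (- alpha) (alpha - 1) h (P t) -
      W (N h) (P t)) @[t --> 0^'+] -->
      (Gamma (1 - alpha))^-1 * (h 0 * beta (- alpha) (alpha - 1)) - 0.
    apply: cvgB.
      by apply: cvgM; [exact: cvg_cst|exact: beta_avg_P_cvg0].
    by apply: (@cvg_comp _ _ _ P (W (N h)) _ 0^'+) => //; exact: int_powR_cvg0.
  apply: cvg_trans h1; apply: near_eq_cvg; near=> t.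
  rewrite wE//.
  by apply/andP; split; near: t; [exact: nbhs_right_gt|exact: nbhs_right_le].
have wy0 t : 0 < t < b -> w t = y0.
  move=> /andP[t0 tb].
  have h1 : w s @[s --> 0^'+] --> w t.
    apply: cvg_trans (@cvg_cst _ (w t) _ (0^'+) _); apply: near_eq_cvg; near=> s.
    apply/esym; apply: wcst => //.
    by near: s; apply: nbhs_right_le.
  exact: (cvg_unique _ h1 wlim).
(* That w equals y0 says that h and the right-hand side of the Volterra equation have the same Abel
   average; injectivity then identifies them. *)
have Vb : bounded_continuous (volt h \o clamp X).
  exact: volterra_clamp_bounded_continuous.
have VE x : 0 <= x <= X -> (volt h \o clamp X) x = volt h x.
  by move=> xX; rewrite /= clamp_id.
move=> x xX; rewrite -VE//; move: x xX.
apply: (beta_avg_inj alpha X alpha_range X_gt0) => // x /andP[x0 xX].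
have [Q [Qc QP PQ Q0]] := shifted_Psi_inverse.
have xX' : 0 < x <= X by rewrite x0 ltW.
rewrite (abel_volterra h _ hb Vb VE)//.
have /andP[Qx0 Qxb] := Q0 x xX'.
have PQx : P (Q x) = x by apply: PQ; rewrite !ltW.
have Qxb' : Q x < b.
  by rewrite lt_neqAle Qxb andbT; apply/eqP => e; move: xX; rewrite -PQx e ltxx.
have := wy0 (Q x); rewrite Qx0 Qxb' => /(_ isT).
rewrite wE ?Qx0// PQx => /eqP; rewrite subr_eq => /eqP e.
by rewrite -e mulrA mulfV ?mul1r// gt_eqF.
Unshelve. all: by end_near. Qed.

End with_nemytskii.

Lemma tempered_IVP_unique_solution : exists y : R -> R,
  tempered_IVP_solution b Psi alpha lambda y0 f y /\
  (forall z : R -> R, tempered_IVP_solution b Psi alpha lambda y0 f z ->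
     forall t : R, 0 < t <= b -> z t = y t).
Proof.
have [N hN] := nemytskii_ex.
have Nb h (hb : bounded_continuous h) := proj1 (hN h hb).
have NE h (hb : bounded_continuous h) := proj2 (hN h hb).
pose Ga := Gamma (1 - alpha); pose Be := beta (- alpha) (alpha - 1).
have [h hb [hV hU]] := volterra_solution alpha X L (Ga * y0 / Be) (Ga / Be) N
  alpha01 X_gt0 L_ge0 Nb (nemytskii_lipschitz N NE).
exists (untransform h); split; first exact: (volterra_sub_solution N).
move=> z /(solution_sub_volterra N Nb NE)[k [kb zk kV]] t tb.
have /andP[P0 PX] := P_itv _ tb.
by rewrite zk// /untransform (hU k)// PX ltW.
Qed.

End ivp.

Theorem theorem5p3 (R : realType) (b : R) (Psi : R -> R)
    (b_gt0 : 0 < b)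
    (Psi_smooth : smooth_in `[0, b] Psi)
    (Psi_mono : {in `[0, b] &, {homo Psi : s t / s <= t}})
    (dPsi_gt0 : {ae (@lebesgue_measure R),
                  forall t, `[0, b]%classic t -> 0 < dPsi b Psi t})
    (alpha lambda y0 L : R) (f : R -> R -> R)
    (alpha_range : 2^-1 < alpha < 1)
    (lambda_ge0 : 0 <= lambda)
    (f_weighted : forall y : R -> R, weighted_C b Psi (1 - alpha) y ->
       weighted_C b Psi (1 - alpha) (fun t => f t (y t)))
    (L_gt0 : 0 < L)
    (f_lipschitz : forall t u v : R, 0 < t <= b ->
       `|f t u - f t v| <= L * `|u - v|)
    (L_bound : L < Gamma (2 * alpha) / Gamma alpha
                   * (Psi b - Psi 0) `^ (- alpha) * expR (- (lambda * Psi b))) :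
  exists y : R -> R,
    tempered_IVP_solution b Psi alpha lambda y0 f y /\
    (forall z : R -> R, tempered_IVP_solution b Psi alpha lambda y0 f z ->
       forall t : R, 0 < t <= b -> z t = y t).
Proof.
apply: (tempered_IVP_unique_solution _ _ b_gt0 Psi_smooth Psi_mono dPsi_gt0
  _ _ alpha_range _ L) => //.
exact: ltW.
Qed.
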